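(* For $x>0$ let $m(x)>0$ denote the median of the gamma distribution with parameter $x$, i.e. the unique positive number satisfying $$\int_0^{m(x)}e^{-t}t^{x-1}\, dt=\frac{1}{2} \int_0^{\infty}e^{-t}t^{x-1}\, dt .$$ Then $m''(x)>0$ for all $x>0$. In particular, $m$ is a strictly convex function on $(0,\infty)$. *)

(* Defs.v *)
From HB Require Import structures.
From mathcomp Require Import all_boot all_order all_algebra.
From mathcomp Require Import all_classical all_reals all_analysis.

Set Implicit Arguments.
Unset Strict Implicit.
Unset Printing Implicit Defensive.

Import Order.TTheory GRing.Theory Num.Theory.
Import numFieldNormedType.Exports.

Local Open Scope classical_set_scope.
Local Open Scope ring_scope.
Local Open Scope convex_scope.

(* The unnormalised density. Integrals below run over intervals open at 0: for
   x < 1 the integrand is singular there, and powR gives it a junk value at 0. *)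
Definition gamma_integrand (R : realType) (x t : R) : R :=
  expR (- t) * t `^ (x - 1).

Definition is_gamma_median (R : realType) (x y : R) : Prop :=
  0 < y /\
  (\int[lebesgue_measure]_(t in `]0%R, y[) (gamma_integrand x t)%:E =
   (1 / 2)%:E *
   \int[lebesgue_measure]_(t in `]0%R, +oo[) (gamma_integrand x t)%:E)%E.

(* The strict counterpart of the library's convex_function. *)
Definition strictly_convex_function (R : numFieldType) (E : lmodType R)
    (E' := convex_lmodType E) (D : set E') (f : E' -> R^o) : Prop :=
  forall t : {i01 R}, 0 < t%:num -> t%:num < 1 ->
    {in D &, forall x y : E', x != y ->
      (f (x <| t |> y) < f x <| t |> f y)%R}.

(* Main.v *)
Require Import Defs.
From HB Require Import structures.
From mathcomp Require Import all_boot all_order all_algebra.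
From mathcomp Require Import all_classical all_reals all_analysis.
From mathcomp Require Import measurable_realfun ring lra.
Set Implicit Arguments.
Unset Strict Implicit.
Unset Printing Implicit Defensive.
Import Order.TTheory GRing.Theory Num.Theory.
Import numFieldNormedType.Exports.
Local Open Scope classical_set_scope.
Local Open Scope ring_scope.

(** Put h(u) = u - 1 + e^(-u), a nonnegative convex function vanishing at 0. The
    substitution t = x e^(-u) turns e^(-t) t^(x-1) dt into a constant multiple of
    e^(-x h(u)) du, so the median is m(x) = x e^(-phi) where phi = phi(x) > 0
    balances the two tails:

      int_0^phi e^(-x h(u)) du = L(x) / 2,
      L(x) = int_0^oo e^(-x h(u)) du - int_0^oo e^(-x h(-u)) du.

    Since m'' = e^(-phi) (x phi'^2 - 2 phi' - x phi''), everything rests on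
    differentiating this equation twice. The terms in L' and L'' combine into
    (x L)'', and this is the only quantity that has to be bounded from above.

    To control L, let a(r) and b(r) be the positive solutions of h(a) = r and
    h(-b) = r. Then L(x) = int_0^oo e^(-x r) rho(r) dr with rho = a' - b', the
    excess of the speed at which the level r is swept on the right over the speed
    on the left. The speeds X = a' and Y = b' satisfy the autonomous system
    X' = X^2 - X^3, Y' = -(Y^2 + Y^3), and near r = 0 they explode like
    1 / sqrt(2 r). Going backwards in r, each of the inequalities

      2/3 <= rho <= 1,    0 <= rho' <= 1/14

    either holds because of the geometry of h (this is the case of rho <= 1), or
    else its failure at one level persists down to r = 0 and contradicts the
    explosion rate (slope_gap_bounds). As x L(x) is the Laplace transform of the
    measure with density rho' and mass rho(0+) = 2/3 at 0, they translate into

      2/3 <= x L <= 1,    (x L)' <= 0,    (x L)'' <= (1/7) / x^3.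

    No Laplace transform of rho is formed in the proofs: level_comparison compares
    the two half-line integrals by following both of them along the levels.

    These bounds give alpha = x phi in [1/3, 5/6] and, by convexity of h,
    phi' <= -phi / x. Inserting them into the twice differentiated equation leaves

      x^3 e^(-x h(phi)) (x phi'^2 - 2 phi' - x phi'')
        >= alpha^2 (1 - alpha) - 1/14 >= 2/27 - 1/14 > 0

    (convexity_algebra). For large x one has alpha -> 1/3, and the true value
    rho'(0+) = 8/135 leaves just enough room: 8/135 < 1/14 < 2/27. *)

(** * Calculus on the real line *)

Section calculus.
Context {R : realType}.
Implicit Types (f g : R -> R) (x a b c : R).

Lemma is_derive1D f g x a b : is_derive x 1 f a -> is_derive x 1 g b ->
  is_derive x 1 (fun t => f t + g t) (a + b).
Proof. exact: is_deriveD. Qed.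

Lemma is_derive1B f g x a b : is_derive x 1 f a -> is_derive x 1 g b ->
  is_derive x 1 (fun t => f t - g t) (a - b).
Proof. exact: is_deriveB. Qed.

Lemma is_derive1N f x a : is_derive x 1 f a -> is_derive x 1 (fun t => - f t) (- a).
Proof. exact: is_deriveN. Qed.

Lemma is_derive1M f g x a b : is_derive x 1 f a -> is_derive x 1 g b ->
  is_derive x 1 (fun t => f t * g t) (f x * b + g x * a).
Proof. exact: is_deriveM. Qed.

Lemma is_derive1X f n x a : is_derive x 1 f a ->
  is_derive x 1 (fun t => f t ^+ n) (n%:R * f x ^+ n.-1 * a).
Proof.
move=> fa; have -> : (fun t => f t ^+ n) = f ^+ n by apply/funext => t; rewrite exprfctE.
exact: is_derive_eq (is_deriveX n fa) _.
Qed.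

Lemma is_derive1_cst c x : is_derive x 1 (fun=> c : R) 0.
Proof. exact: is_derive_cst. Qed.

Lemma is_derive1_id x : is_derive x 1 (fun t : R => t) 1.
Proof. exact: is_derive_id. Qed.

Lemma is_derive1V f x a : f x != 0 -> is_derive x 1 f a ->
  is_derive x 1 (fun t => (f t)^-1) (- (f x) ^- 2 * a).
Proof. by move=> fx0 fa; exact: is_deriveV. Qed.

Lemma is_derive1_expR f x a : is_derive x 1 f a ->
  is_derive x 1 (fun t => expR (f t)) (expR (f x) * a).
Proof. by move=> fa; apply: (@is_derive1_comp _ expR f). Qed.

Lemma is_derive1_continuous f x a : is_derive x 1 f a -> {for x, continuous f}.
Proof.
by move=> fa; apply: differentiable_continuous; apply/derivable1_diffP; case: fa.
Qed.

Lemma is_derive1_derive1 f x a : is_derive x 1 f a -> (f^`())%classic x = a.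
Proof. by move=> fa; rewrite derive1E derive_val. Qed.

Lemma is_derive1_within f df a b :
    (forall x, a <= x <= b -> is_derive x 1 f (df x)) ->
  {within `[a, b], continuous f}.
Proof.
move=> fdf; apply: derivable_within_continuous => x; rewrite in_itv/= => xab.
by case: (fdf _ xab).
Qed.

Lemma ge0_is_derive1_le f df a b : a <= b ->
    (forall x, a <= x <= b -> is_derive x 1 f (df x)) ->
    (forall x, a <= x <= b -> 0 <= df x) ->
  f a <= f b.
Proof.
move=> ab fdf df0.
have [x|x|c cab fab] := @MVT_segment _ f df a b ab.
- by rewrite in_itv/= => /andP[/ltW ax /ltW xb]; apply: fdf; rewrite ax.
- exact: is_derive1_within fdf x.
- by rewrite -subr_ge0 fab mulr_ge0 ?subr_ge0// df0// -(itvP cab).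
Qed.

Lemma gt0_is_derive1_lt f df a b : a < b ->
    (forall x, a <= x <= b -> is_derive x 1 f (df x)) ->
    (forall x, a < x < b -> 0 < df x) ->
  f a < f b.
Proof.
move=> ab fdf df0.
have [x|x|c cab fab] := @MVT _ f df a b ab.
- by rewrite in_itv/= => /andP[/ltW ax /ltW xb]; apply: fdf; rewrite ax.
- exact: is_derive1_within fdf x.
- by rewrite -subr_gt0 fab mulr_gt0 ?subr_gt0// df0// -(itvP cab).
Qed.

Lemma lt0_is_derive1_left f x a : is_derive x 1 f a -> a < 0 ->
  \forall t \near x^'-, f x < f t.
Proof.
move=> /is_derive1_caratheodory[g [fE cg gx]] a0.
have /(cvgr_lt _) /(_ 0) : g t @[t --> x] --> g x by exact: cg.
rewrite gx => /(_ a0) g0.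
near=> t.
rewrite -subr_gt0 fE nmulr_rgt0 ?subr_lt0//.
near: t; exact: cvg_at_left_filter g0.
Unshelve. all: by end_near. Qed.

(** At a maximum of [f] on a segment ending at [b], [f] is at least [c], so it
    decreases strictly there; hence the maximum can only sit at the left end. *)
Lemma backward_barrier f df b c : 0 < b ->
    (forall x, 0 < x <= b -> is_derive x 1 f (df x)) ->
    (forall x, 0 < x <= b -> c <= f x -> df x < 0) ->
    c <= f b ->
  forall x, 0 < x <= b -> c <= f x.
Proof.
move=> b0 fdf df0 cfb a /andP[a0 ab].
rewrite leNgt; apply/negP => fac.
have inI x : a <= x <= b -> 0 < x <= b.
  by move=> /andP[/(lt_le_trans a0) -> ->].
have [|m mab mmax] := @EVT_max _ f a b ab.
  by apply: is_derive1_within (fun x xab => fdf x (inI x xab)).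
have /andP[am mb] : a <= m <= b by move: mab; rewrite in_itv.
have cfm : c <= f m.
  by rewrite (le_trans cfb)// mmax// in_itv/= ab lexx.
have {}am : a < m.
  rewrite lt_neqAle am andbT; apply/eqP => am'.
  by move: fac; rewrite am' ltNge cfm.
have m0 : 0 < m <= b by rewrite mb (lt_trans a0).
near m^'- => t.
have : f m < f t.
  by near: t; exact: lt0_is_derive1_left (fdf _ m0) (df0 _ m0 cfm).
apply/negP; rewrite -leNgt mmax// in_itv/=.
rewrite (le_trans _ mb) ?andbT; first by near: t; exact: nbhs_left_ge.
by near: t; exact: nbhs_left_le.
Unshelve. all: by end_near. Qed.

(** The hypothesis says that [x * f x] is nonincreasing; being positive at [b] it
    stays bounded away from 0, whereas it tends to 0 with [x] when [f] is bounded. *)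
Lemma no_backward_blowup f df b : 0 < b ->
    (forall x, 0 < x <= b -> is_derive x 1 f (df x)) ->
    (forall x, 0 < x <= b -> 0 < f x <= 1) ->
    (forall x, 0 < x <= b -> f x + x * df x <= 0) ->
  False.
Proof.
move=> b0 fdf f01 fxdf.
have bb : 0 < b <= b by rewrite b0 lexx.
have /andP[fb0 fb1] := f01 _ bb.
have decr x : 0 < x <= b -> b * f b <= x * f x.
  move=> /andP[x0 xb]; rewrite -lerN2.
  have inI y : x <= y <= b -> 0 < y <= b.
    by move=> /andP[/(lt_le_trans x0) -> ->].
  apply: (@ge0_is_derive1_le (fun y => - (y * f y)) (fun y => - (y * df y + f y * 1)) x b xb).
    move=> y /inI yb; apply: is_derive1N.
    by apply: is_derive1M; exact: fdf.
  by move=> y /inI yb; rewrite oppr_ge0 mulr1 addrC fxdf.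
(* At this point [x * f x <= x] is already half of the lower bound [b * f b]. *)
pose x := b * f b / 2.
have x0 : 0 < x by rewrite /x !mulr_gt0.
have xb : 0 < x <= b.
  by rewrite x0/= /x -mulrA ler_piMr ?(ltW b0)//; lra.
have /andP[fx0 fx1] := f01 _ xb.
have := decr _ xb; apply/negP; rewrite -ltNge.
rewrite (@le_lt_trans _ _ x)//; first by rewrite ler_piMr// ltW.
by rewrite /x ltr_pdivrMr// ltr_pMr ?mulr_gt0//; lra.
Qed.

Lemma increasing_inverse f df : f 0 = 0 ->
    (forall x, is_derive x 1 f (df x)) ->
    (forall x, 0 < x -> 0 < df x) ->
    (forall y, exists2 x, 0 <= x & y <= f x) ->
  exists g : R -> R, forall y, 0 < y ->
    [/\ 0 < g y, f (g y) = y & is_derive y 1 g (df (g y))^-1].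
Proof.
move=> f0 fdf df0 funb.
have cf x : {for x, continuous f} by exact: is_derive1_continuous (fdf x).
have incr a b : 0 <= a -> a < b -> f a < f b.
  move=> a0 ab; apply: (@gt0_is_derive1_lt _ df) => // x /andP[ax _].
  by rewrite df0// (le_lt_trans a0).
have /choice[g gP] (y : R) : exists x, 0 < y -> 0 < x /\ f x = y.
  have [x x0 yfx] := funb y.
  have [y0|y0] := ltP 0 y; last by exists 0.
  have [|||c] := @IVT _ f 0 x y.
  - by [].
  - exact: continuous_subspaceT.
  - rewrite f0 ge_min (ltW y0)/= le_max yfx orbT//.
  rewrite in_itv/= => /andP[c0 _] fc; exists c => _; split => //.
  rewrite lt_neqAle c0 andbT; apply/eqP => c0'.
  by move: y0; rewrite -fc -c0' f0 ltxx.
exists g => y y0; have [gy0 fgy] := gP _ y0; split => //.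
rewrite -[in is_derive y]fgy.
apply: (@is_derive_inverse _ f) => //.
- near=> x.
  have x0 : 0 < x by near: x; exact: lt_nbhsr.
  have fx0 : 0 < f x by rewrite -f0 incr.
  have [gfx0 fgfx] := gP _ fx0.
  have [xl|xl|//] := ltgtP (g (f x)) x.
  + by have := incr _ _ (ltW gfx0) xl; rewrite fgfx ltxx.
  + by have := incr _ _ (ltW x0) xl; rewrite fgfx ltxx.
- by near=> x; exact: cf.
- by rewrite gt_eqF// df0.
Unshelve. all: by end_near. Qed.

End calculus.

(** * The autonomous system satisfied by the two level speeds *)

Section slope_gap_ode.
Context {R : realType}.
Variables X Y : R -> R.
Implicit Types r s e : R.

(** The derivative of X - Y along the system below. *)
Definition gap_rate (x y : R) : R := y ^+ 3 + y ^+ 2 - x ^+ 3 + x ^+ 2.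

Hypothesis dX : forall r, 0 < r -> is_derive r 1 X (X r ^+ 2 - X r ^+ 3).
Hypothesis dY : forall r, 0 < r -> is_derive r 1 Y (- (Y r ^+ 2 + Y r ^+ 3)).
Hypothesis X_gt1 : forall r, 0 < r -> 1 < X r.
Hypothesis Y_gt0 : forall r, 0 < r -> 0 < Y r.
Hypothesis Y_le_X : forall r, 0 < r -> Y r <= X r.
Hypothesis X_le_Y1 : forall r, 0 < r -> X r <= Y r + 1.
(* The explosion at 0 enters only through this lower bound, X >= 1 / sqrt(2 r). *)
Hypothesis X_large : forall r, 0 < r -> 1 <= 2 * r * X r ^+ 2.

(* With D = X - Y and S = X + Y one has 4 D' = M - S^2 (3 D - 2), so that D = 2/3 is
   the only value compatible with S = +oo at r = 0. Differentiating once more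
   gives the linear equation [dWr] for W = D'. *)
Let D r := X r - Y r.
Let W r := gap_rate (X r) (Y r).
Let S2 r := (X r + Y r) ^+ 2.
Let M r := D r ^+ 2 * (2 - D r).
Let T r := D r * (4 - 3 * D r).

Let dD r : 0 < r -> is_derive r 1 D (W r).
Proof.
move=> r0; apply: is_derive_eq (is_derive1B (dX r0) (dY r0)) _.
rewrite /W /gap_rate; ring.
Qed.

Let WE r : W r = (M r - S2 r * (3 * D r - 2)) / 4.
Proof. rewrite /W /M /S2 /D /gap_rate; by field. Qed.

Let dWr r := (S2 r - T r) * M r / 8 - W r * (5 * S2 r - 3 * T r) / 4.

Let dW r : 0 < r -> is_derive r 1 W (dWr r).
Proof.
move=> r0.
apply: is_derive_eq
  (is_derive1D (is_derive1B (is_derive1D (is_derive1X 3 (dY r0)) (is_derive1X 2 (dY r0)))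
    (is_derive1X 3 (dX r0))) (is_derive1X 2 (dX r0))) _.
rewrite /dWr /W /S2 /T /M /D /gap_rate /=; by field.
Qed.

Let D01 r : 0 < r -> 0 <= D r <= 1.
Proof. by move=> r0; rewrite subr_ge0 Y_le_X//= lerBlDl X_le_Y1. Qed.

Let M_ge0 r : 0 < r -> 0 <= M r.
Proof. by move=> /D01/andP[D0 D1]; rewrite mulr_ge0 ?sqr_ge0//; lra. Qed.

Let M_le1 r : 0 < r -> M r <= 1.
Proof.
move=> /D01/andP[D0 D1]; rewrite -subr_ge0.
rewrite (_ : 1 - M r = (1 - D r) * (1 + D r * (1 - D r))); last by rewrite /M; ring.
have D1' : 0 <= 1 - D r by lra.
by rewrite mulr_ge0// addr_ge0// mulr_ge0.
Qed.

Let T_ge0 r : 0 < r -> 0 <= T r.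
Proof. by move=> /D01/andP[D0 D1]; rewrite mulr_ge0//; lra. Qed.

Let S2_gtT r : 0 < r -> T r < S2 r.
Proof.
move=> r0; rewrite -subr_gt0.
have -> : S2 r - T r = 4 * (X r * (X r - 1) + Y r * (Y r + 1 - X r)).
  by rewrite /S2 /T /D; ring.
rewrite mulr_gt0// ltr_wpDr ?mulr_gt0 ?mulr_ge0 ?subr_ge0 ?subr_gt0 ?X_gt1//.
- exact: ltW (Y_gt0 r0).
- exact: X_le_Y1.
- exact: lt_trans (X_gt1 r0).
Qed.

(** The constant 3/2 stands for the limit value 2 of r S^2; what is needed below is
    that 3/4 of it exceeds 1, the threshold of [no_backward_blowup], and the margin
    in [gap_rate_le]. *)
Let S2_large r : 0 < r -> r <= 1 / 32 -> 3 / 2 <= r * S2 r.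
Proof.
move=> r0 r32; have X1 := X_gt1 r0; have XL := X_large r0.
have X4 : 4 <= X r.
  rewrite leNgt; apply/negP => X4; have : X r ^+ 2 < 16 by nra.
  nra.
have S2X : (2 * X r - 1) ^+ 2 <= S2 r.
  by have := X_le_Y1 r0; rewrite /S2; nra.
have : (2 * X r - 1) ^+ 2 >= 3 * X r ^+ 2 by nra.
nra.
Qed.

(** If D < 2/3 at some level, then 2/3 - D grows as the level decreases, at a
    relative rate of at least 3/4 S^2 >= 9 / (8 r), so it cannot be bounded. *)
Let gap_ge23 r : 0 < r -> 2 / 3 <= D r.
Proof.
move=> r0; rewrite leNgt; apply/negP => Dr.
pose f s := 2 / 3 - D s.
have df s : 0 < s -> is_derive s 1 f (- W s).
  move=> s0; apply: is_derive_eq (is_derive1B (is_derive1_cst _ _) (dD s0)) _.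
  by rewrite sub0r.
have fpos s : 0 < s <= r -> f r <= f s.
  apply: (@backward_barrier _ f (fun s => - W s) r (f r) r0) => [t /andP[t0 _]|t /andP[t0 _]|];
    [exact: df| |exact: lexx].
  move=> frt; have ft : 0 < f t by rewrite (lt_le_trans _ frt)// subr_gt0.
  rewrite oppr_lt0 WE.
  have Mt := M_ge0 t0; have St := le_lt_trans (T_ge0 t0) (S2_gtT t0).
  by move: ft; rewrite /f => ft; nra.
pose b := Num.min r (1 / 32).
have b0 : 0 < b by rewrite lt_min r0/=; lra.
apply: (@no_backward_blowup _ f (fun s => - W s) b b0) => s /andP[s0].
all: rewrite le_min => /andP[sr s32].
- exact: df.
- have : f r <= f s by rewrite fpos// s0.
  move: Dr; rewrite /f; have /andP[D0 _] := D01 s0; lra.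
- have : f r <= f s by rewrite fpos// s0.
  move=> frs; have fs : 0 < f s by rewrite (lt_le_trans _ frs)// subr_gt0.
  have MM := M_ge0 s0; have SS := S2_large s0 s32.
  rewrite WE (_ : 3 * D s - 2 = - 3 * f s); last by rewrite /f; lra.
  nra.
Qed.

(** In the same way, D - 2/3 cannot stay away from 0 near r = 0; together with the
    monotonicity of D this is the limit D(0+) = 2/3. *)
Let gap_small e r : 0 < r -> 0 < e ->
  ~ (forall s, 0 < s <= r -> e <= D s - 2 / 3).
Proof.
move=> r0 e0 De.
pose b := Num.min r (Num.min (1 / 32) (e / 2)).
have b0 : 0 < b by rewrite !lt_min r0/=; lra.
apply: (@no_backward_blowup _ (fun s => D s - 2 / 3) W b b0) => s /andP[s0].
all: rewrite !le_min => /and3P[sr s32 se].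
- by apply: is_derive_eq (is_derive1B (dD s0) (is_derive1_cst _ _)) _; rewrite subr0.
- by have := De _ (introT andP (conj s0 sr)); have /andP[_ D1] := D01 s0; lra.
- have := De _ (introT andP (conj s0 sr)); have MM := M_le1 s0.
  have := S2_large s0 s32; rewrite WE; nra.
Qed.

(** Where W < 0, the equation for W makes it increase. So a negative value of W
    persists down to 0; there D is then decreasing and above 2/3, hence away from
    2/3, contrary to [gap_small]. *)
Let gap_rate_ge0 r : 0 < r -> 0 <= W r.
Proof.
move=> r0; rewrite leNgt; apply/negP => Wr.
have Wneg s : 0 < s <= r -> W s < 0.
  move=> sr; rewrite -oppr_gt0; apply: (@lt_le_trans _ _ (- W r)); first by rewrite oppr_gt0.
  move: s sr; apply: (@backward_barrier _ (fun s => - W s) (fun s => - dWr s)) => // s /andP[s0 _].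
    exact: is_derive1N (dW s0).
  move=> WW; have Ws : W s < 0 by rewrite -oppr_gt0 (lt_le_trans _ WW)// oppr_gt0.
  rewrite oppr_lt0 /dWr.
  have TT := T_ge0 s0; have ST := S2_gtT s0; have MM := M_ge0 s0.
  have : 0 <= (S2 s - T s) * M s by rewrite mulr_ge0// subr_ge0 ltW.
  have : 0 < (- W s) * (5 * S2 s - 3 * T s) by rewrite mulr_gt0 ?oppr_gt0//; lra.
  lra.
apply: (@gap_small (D r - 2 / 3) r r0).
  have := Wneg r; rewrite r0 lexx => /(_ isT); rewrite WE.
  have := M_ge0 r0; have := le_lt_trans (T_ge0 r0) (S2_gtT r0).
  by move=> S0 M0 W0; rewrite ltNge; apply/negP => D0; nra.
move=> s /andP[s0 sr]; rewrite lerD2r -lerN2.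
apply: (@ge0_is_derive1_le _ (fun t => - D t) (fun t => - W t)) => // t /andP[st tr].
  by apply: is_derive1N; apply: dD; exact: lt_le_trans st.
by rewrite oppr_ge0 ltW// Wneg// tr (lt_le_trans s0).
Qed.

Let gap_mono s r : 0 < s -> s <= r -> D s <= D r.
Proof.
move=> s0 sr; apply: (@ge0_is_derive1_le _ D W) => // t /andP[st _].
  exact: dD (lt_le_trans s0 st).
exact: gap_rate_ge0 (lt_le_trans s0 st).
Qed.

(** The sign condition for the barrier W = 1/14. As S^2 enters linearly, only its
    largest value compatible with W >= 1/14 matters; after substituting it, the
    identity T (3 D - 2) = M - 8 D (1 - D)^2 and the bound D (1 - D)^2 <= 2/27
    leave a comparison of quadratic polynomials in M. *)
Let barrier_poly (d s2 : R) : 2 / 3 <= d <= 1 ->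
    0 <= s2 -> s2 * (3 * d - 2) <= d ^+ 2 * (2 - d) - 4 / 14 ->
  s2 * (d ^+ 2 * (2 - d) - 10 / 14) < d * (4 - 3 * d) * (d ^+ 2 * (2 - d) - 6 / 14).
Proof.
move=> /andP[d23 d1] s20; set m := d ^+ 2 * (2 - d); set t := d * (4 - 3 * d) => H.
have m1627 : 16 / 27 <= m.
  rewrite -subr_ge0 (_ : _ - _ = (d - 2 / 3) * (4 / 3 * d - d ^+ 2 + 8 / 9)).
    by rewrite mulr_ge0//; nra.
  by rewrite /m; field.
have m1 : m <= 1.
  rewrite -subr_ge0 (_ : _ - _ = (1 - d) * (1 + d - d ^+ 2)); last by rewrite /m; ring.
  by rewrite mulr_ge0//; nra.
have t0 : 0 < t by rewrite /t; nra.
have [m10|m10] := leP m (10 / 14); first by nra.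
have d0 : 0 < 3 * d - 2.
  rewrite subr_gt0 ltNge; apply/negP => d0; have dE : d = 2 / 3 by lra.
  by move: m10; rewrite /m dE; lra.
rewrite -(ltr_pM2r d0).
apply: (@le_lt_trans _ _ ((m - 4 / 14) * (m - 10 / 14))).
  by rewrite mulrAC ler_wpM2r//; lra.
have mt : t * (3 * d - 2) = m - 8 * (d * (1 - d) ^+ 2) by rewrite /m /t; ring.
rewrite mulrAC mt.
have : d * (1 - d) ^+ 2 <= 2 / 27.
  rewrite -subr_ge0 (_ : _ - _ = (d - 2 / 3) * (4 / 3 * d - d ^+ 2 - 1 / 9)).
    by rewrite mulr_ge0//; nra.
  by field.
nra.
Qed.

(** A value of W above 1/14 persists down to 0. Then D - 2/3 >= r / 14, and
    r S^2 >= 3/2 forces 4 W = M - S^2 (3 D - 2) to be at most about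
    16/27 - 9/28 < 4/14 near 0. *)
Let gap_rate_le r : 0 < r -> W r <= 1 / 14.
Proof.
move=> r0; rewrite leNgt; apply/negP => Wr.
have Wbig s : 0 < s <= r -> 1 / 14 <= W s.
  move=> sr; apply: (@backward_barrier _ W dWr r) => //; last exact: ltW.
  - by move=> t /andP[t0 _]; exact: dW.
  move=> t /andP[t0 _] Wt; rewrite /dWr.
  have TT := T_ge0 t0; have ST := S2_gtT t0; have /andP[_ D1] := D01 t0.
  have := @barrier_poly (D t) (S2 t).
  rewrite gap_ge23// D1 => /(_ isT (le_trans TT (ltW ST))); rewrite -/(M t) -/(T t).
  have -> : S2 t * (3 * D t - 2) = M t - 4 * W t by rewrite WE; field.
  have -> : M t - 4 * W t <= M t - 4 / 14 by lra.
  move=> /(_ isT).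
  have : 0 <= (W t - 1 / 14) * (5 * S2 t - 3 * T t) by rewrite mulr_ge0//; lra.
  nra.
have small : exists2 q, 0 < q <= r & D q - 2 / 3 < 1 / 200.
  apply: contrapT => H; apply: (@gap_small (1 / 200) r) => // s sr.
  by rewrite leNgt; apply/negP => Ds; apply: H; exists s.
have [q /andP[q0 qr] Dq] := small.
pose s := Num.min q (1 / 32).
have s0 : 0 < s by rewrite lt_min q0/=; lra.
have sr : s <= r by rewrite (le_trans _ qr)// ge_min lexx.
have s32 : s <= 1 / 32 by rewrite ge_min lexx orbT.
have Ds : D s - 2 / 3 < 1 / 200.
  by apply: le_lt_trans Dq; rewrite lerD2r gap_mono// ge_min lexx.
(* Integrating W >= 1/14 from u to s, where D u >= 2/3 and u is arbitrarily small. *)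
have Dlin : 2 / 3 + s / 14 <= D s.
  rewrite leNgt; apply/negP => Dlt.
  pose e := 2 / 3 + s / 14 - D s.
  pose u := Num.min s (7 * e).
  have e0 : 0 < e by rewrite subr_gt0.
  have u0 : 0 < u by rewrite lt_min s0/= mulr_gt0.
  have us : u <= s by rewrite ge_min lexx.
  have ue : u <= 7 * e by rewrite ge_min lexx orbT.
  have : D u - u / 14 <= D s - s / 14.
    apply: (@ge0_is_derive1_le _ (fun t => D t - t / 14) (fun t => W t - 1 / 14)) => // t /andP[ut ts].
      apply: is_derive1B; first exact: dD (lt_le_trans u0 ut).
      apply: is_derive_eq (is_derive1M (is_derive1_id _) (is_derive1_cst _ _)) _.
      by rewrite mulr0 add0r mulr1 div1r.
    by rewrite subr_ge0 Wbig// (lt_le_trans u0 ut) (le_trans ts).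
  have := gap_ge23 u0; rewrite /e in e0 ue *; lra.
have := Wbig s; rewrite s0 sr => /(_ isT); rewrite WE.
have SS := S2_large s0 s32.
have : M s <= 16 / 27 + 4 / 3 * (D s - 2 / 3).
  have d23 := gap_ge23 s0; have /andP[_ d1] := D01 s0.
  rewrite /M -subr_ge0 (_ : _ - _ = (D s - 2 / 3) ^+ 3); last by field.
  by rewrite exprn_ge0//; lra.
have : s * S2 s * 3 / 14 <= S2 s * (3 * D s - 2).
  have := le_trans (T_ge0 s0) (ltW (S2_gtT s0)) => S0.
  rewrite (_ : _ / 14 = S2 s * (3 * s / 14)); last by field.
  by rewrite ler_wpM2l//; lra.
lra.
Qed.

Lemma slope_gap_bounds r : 0 < r ->
  [/\ 2 / 3 <= X r - Y r, X r - Y r <= 1, 0 <= gap_rate (X r) (Y r)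
    & gap_rate (X r) (Y r) <= 1 / 14].
Proof.
move=> r0; split; [exact: gap_ge23| |exact: gap_rate_ge0|exact: gap_rate_le].
by have /andP[] := D01 r0.
Qed.

End slope_gap_ode.

(** * The phase function and its level sets *)

Section level_sets.
Context {R : realType}.
Implicit Types u v r x : R.

(** Minus the logarithm of the integrand e^(-t) t^x at t = x e^(-u), divided by x and
    normalised so that its minimum, at u = 0, is 0. *)
Definition phase u : R := u - 1 + expR (- u).

Lemma phase0 : phase 0 = 0.
Proof. by rewrite /phase oppr0 expR0; lra. Qed.

Lemma is_derive_phase u : is_derive u 1 phase (1 - expR (- u)).
Proof.
apply: is_derive_eq (is_derive1D (is_derive1B (is_derive1_id _) (is_derive1_cst 1 _))
  (is_derive1_expR (is_derive1N (is_derive1_id _)))) _.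
by rewrite subr0 mulrN1.
Qed.

Lemma is_derive_phaseN u :
  is_derive u 1 (fun v => phase (- v)) (expR u - 1).
Proof.
apply: is_derive_eq (is_derive1_comp (is_derive_phase (- u)) (is_derive1N (is_derive1_id u))) _.
by rewrite opprK mulrN1; ring.
Qed.

Lemma phase_ge0 u : 0 <= phase u.
Proof. by rewrite /phase; have := expR_ge1Dx (- u); lra. Qed.

Lemma phase_geB1 u : u - 1 <= phase u.
Proof. by rewrite /phase; have := expR_ge0 (- u); lra. Qed.

Lemma phase_le u : 0 <= u -> phase u <= u.
Proof. by move=> u0; rewrite /phase; have := expR_le1 (- u); rewrite oppr_le0 u0; lra. Qed.

(** The left branch is steeper than the right one, since cosh u >= 1. This is the
    asymmetry responsible for m(x) < x. *)
Lemma phase_leN u : 0 <= u -> phase u <= phase (- u).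
Proof.
move=> u0; rewrite -subr_ge0.
have -> : 0 = phase (- 0) - phase 0 by rewrite oppr0 subrr.
apply: (@ge0_is_derive1_le _ (fun v => phase (- v) - phase v)
  (fun v => expR v - 1 - (1 - expR (- v)))) => // v _.
  exact: is_derive1B (is_derive_phaseN v) (is_derive_phase v).
by have := expR_ge1Dx v; have := expR_ge1Dx (- v); lra.
Qed.

Lemma phase_geNB1 u : 0 <= u -> u - 1 <= phase (- u).
Proof. by move=> u0; exact: le_trans (phase_geB1 u) (phase_leN u0). Qed.

(** Convexity: the tangent at [u] lies below [phase] at 0. *)
Lemma phase_le_slope u : phase u <= u * (1 - expR (- u)).
Proof.
rewrite /phase; have := expR_ge1Dx u; have := expR_gt0 (- u).
have := expRxMexpNx_1 u; nra.
Qed.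


Lemma phase_lt u v : 0 <= u -> u < v -> phase u < phase v.
Proof.
move=> u0 uv; apply: (@gt0_is_derive1_lt _ phase (fun u => 1 - expR (- u))) => // x.
  by move=> _; exact: is_derive_phase.
by move=> /andP[ux _]; rewrite subr_gt0 expR_lt1 oppr_lt0 (le_lt_trans u0).
Qed.

Lemma phase_le_mono u v : 0 <= u -> u <= v -> phase u <= phase v.
Proof.
by move=> u0; rewrite le_eqVlt => /predU1P[->//|uv]; exact/ltW/phase_lt.
Qed.

Lemma phaseN_lt u v : 0 <= u -> u < v -> phase (- u) < phase (- v).
Proof.
move=> u0 uv; apply: (@gt0_is_derive1_lt _ (fun v => phase (- v)) (fun v => expR v - 1)) => // x.
  by move=> _; exact: is_derive_phaseN.
by move=> /andP[ux _]; rewrite subr_gt0 expR_gt1 (le_lt_trans u0).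
Qed.

Lemma slope_inverses : exists a b : R -> R, forall r, 0 < r ->
  [/\ 0 < a r, 0 < b r, phase (a r) = r, phase (- b r) = r
    & is_derive r 1 a (1 - expR (- a r))^-1 /\ is_derive r 1 b (expR (b r) - 1)^-1].
Proof.
have [|u|u u0|y|a aP] := @increasing_inverse _ phase (fun u => 1 - expR (- u)).
- exact: phase0.
- exact: is_derive_phase.
- by rewrite subr_gt0 expR_lt1 oppr_lt0.
- exists (Num.max 0 (y + 1)); first by rewrite le_max lexx.
  by apply: le_trans (phase_geB1 _); rewrite lerBrDr le_max lexx orbT.
have [|u|u u0|y|b bP] := @increasing_inverse _ (fun u => phase (- u)) (fun u => expR u - 1).
- by rewrite oppr0 phase0.
- exact: is_derive_phaseN.
- by rewrite subr_gt0 expR_gt1.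
- exists (Num.max 0 (y + 1)); first by rewrite le_max lexx.
  apply: le_trans (phase_geNB1 _); last by rewrite le_max lexx.
  by rewrite lerBrDr le_max lexx orbT.
exists a, b => r r0; have [a0 pa da] := aP _ r0; have [b0 pb db] := bP _ r0.
by split.
Qed.

(** The positive solutions a(r) and b(r) of phase(a) = r and phase(-b) = r. *)
Definition level_pos : R -> R := proj1_sig (cid slope_inverses).
Definition level_neg : R -> R := proj1_sig (cid (proj2_sig (cid slope_inverses))).

Lemma levelP r : 0 < r ->
  [/\ 0 < level_pos r, 0 < level_neg r,
      phase (level_pos r) = r, phase (- level_neg r) = r
    & is_derive r 1 level_pos (1 - expR (- level_pos r))^-1 /\
      is_derive r 1 level_neg (expR (level_neg r) - 1)^-1].
Proof.
rewrite /level_neg /level_pos; case: cid => a /= aP; case: cid => b /= bP.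
exact: bP.
Qed.

(** The derivatives of the two levels, by the inverse function rule. *)
Definition speed_pos r := (1 - expR (- level_pos r))^-1.
Definition speed_neg r := (expR (level_neg r) - 1)^-1.
Definition speed_gap r := speed_pos r - speed_neg r.
Definition speed_gap_rate r := gap_rate (speed_pos r) (speed_neg r).

Lemma is_derive_speed_pos r : 0 < r ->
  is_derive r 1 speed_pos (speed_pos r ^+ 2 - speed_pos r ^+ 3).
Proof.
move=> r0; have [a0 _ _ _ [da _]] := levelP r0.
have p0 : 1 - expR (- level_pos r) != 0.
  by rewrite gt_eqF// subr_gt0 expR_lt1 oppr_lt0.
apply: is_derive_eq (@is_derive1V _ (fun s => 1 - expR (- level_pos s)) r _ p0
  (is_derive1B (is_derive1_cst _ _) (is_derive1_expR (is_derive1N da)))) _.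
rewrite /speed_pos; move: p0; set e := expR _ => p0.
by field.
Qed.

Lemma is_derive_speed_neg r : 0 < r ->
  is_derive r 1 speed_neg (- (speed_neg r ^+ 2 + speed_neg r ^+ 3)).
Proof.
move=> r0; have [_ b0 _ _ [_ db]] := levelP r0.
have q0 : expR (level_neg r) - 1 != 0 by rewrite gt_eqF// subr_gt0 expR_gt1.
apply: is_derive_eq (@is_derive1V _ (fun s => expR (level_neg s) - 1) r _ q0
  (is_derive1B (is_derive1_expR db) (is_derive1_cst _ _))) _.
rewrite /speed_neg; move: q0; set e := expR _ => q0.
by field.
Qed.

Lemma speed_pos_gt1 r : 0 < r -> 1 < speed_pos r.
Proof.
move=> r0; have [a0 _ _ _ _] := levelP r0.
by rewrite /speed_pos invf_gt1 ?subr_gt0 ?expR_lt1 ?oppr_lt0// gtrBl expR_gt0.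
Qed.

Lemma speed_neg_gt0 r : 0 < r -> 0 < speed_neg r.
Proof.
by move=> r0; have [_ b0 _ _ _] := levelP r0; rewrite invr_gt0 subr_gt0 expR_gt1.
Qed.

(** The derivative of the difference of the two sides is (h')^2, because h'' = 1 - h'.
    In the same way k'' = 1 + k' for k(u) = h(-u) in the next lemma. *)
Lemma phase_ge_slope_sqr u : 0 <= u -> (1 - expR (- u)) ^+ 2 / 2 <= phase u.
Proof.
move=> u0; rewrite -subr_ge0.
have -> : 0 = phase 0 - (1 - expR (- 0)) ^+ 2 / 2.
  by rewrite phase0 oppr0 expR0; lra.
pose df v := (1 - expR (- v)) ^+ 2.
apply: (@ge0_is_derive1_le _ (fun v => phase v - (1 - expR (- v)) ^+ 2 / 2) df) => // v /andP[v0 _].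
  apply: is_derive_eq (is_derive1B (is_derive_phase v) (is_derive1M (is_derive1X 2
   (is_derive1B (is_derive1_cst 1 v) (is_derive1_expR (is_derive1N (is_derive1_id v)))))
   (is_derive1_cst 2^-1 v))) _.
  by rewrite /df /=; field.
exact: sqr_ge0.
Qed.

Lemma phaseN_le_slope_sqr u : 0 <= u -> phase (- u) <= (expR u - 1) ^+ 2 / 2.
Proof.
move=> u0; rewrite -subr_ge0.
have -> : 0 = (expR 0 - 1) ^+ 2 / 2 - phase (- 0).
  by rewrite oppr0 phase0 expR0; lra.
pose df v : R := (expR v - 1) ^+ 2.
apply: (@ge0_is_derive1_le _ (fun v => (expR v - 1) ^+ 2 / 2 - phase (- v)) df) => // v /andP[v0 _].
  apply: is_derive_eq (is_derive1B (is_derive1M (is_derive1X 2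
   (is_derive1B (is_derive1_expR (is_derive1_id v)) (is_derive1_cst 1 v)))
   (is_derive1_cst 2^-1 v)) (is_derive_phaseN v)) _.
  by rewrite /df /=; field.
exact: sqr_ge0.
Qed.

Lemma speed_pos_large r : 0 < r -> 1 <= 2 * r * speed_pos r ^+ 2.
Proof.
move=> r0; have [a0 _ pa _ _] := levelP r0.
have := phase_ge_slope_sqr (ltW a0); rewrite pa => H.
have p0 : 0 < 1 - expR (- level_pos r) by rewrite subr_gt0 expR_lt1 oppr_lt0.
rewrite /speed_pos exprVn ler_pdivlMr ?exprn_gt0//; lra.
Qed.

Lemma speed_neg_le r : 0 < r -> speed_neg r <= speed_pos r.
Proof.
move=> r0; have [a0 b0 pa pb _] := levelP r0.
have := phase_ge_slope_sqr (ltW a0); rewrite pa => Ha.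
have := phaseN_le_slope_sqr (ltW b0); rewrite pb => Hb.
have p0 : 0 < 1 - expR (- level_pos r) by rewrite subr_gt0 expR_lt1 oppr_lt0.
have q0 : 0 < expR (level_neg r) - 1 by rewrite subr_gt0 expR_gt1.
rewrite /speed_pos /speed_neg lef_pV2 ?posrE//.
have : (1 - expR (- level_pos r)) ^+ 2 <= (expR (level_neg r) - 1) ^+ 2 by lra.
by rewrite ler_pXn2r// nnegrE ltW.
Qed.

Lemma level_neg_le r : 0 < r -> level_neg r <= level_pos r.
Proof.
move=> r0; have [a0 b0 pa pb _] := levelP r0; rewrite leNgt; apply/negP => ab.
have := phase_leN (ltW a0); rewrite pa; apply/negP; rewrite -ltNge -[ltRHS]pb.
exact: phaseN_lt (ltW a0) ab.
Qed.

Lemma speed_pos_le r : 0 < r -> speed_pos r <= speed_neg r + 1.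
Proof.
move=> r0; have [a0 b0 _ _ _] := levelP r0.
have ba := level_neg_le r0.
have q0 : 0 < expR (level_neg r) - 1 by rewrite subr_gt0 expR_gt1.
have ea : expR (level_neg r) <= expR (level_pos r) by rewrite ler_expR.
have p0 : 0 < expR (level_pos r) - 1 by lra.
rewrite /speed_pos /speed_neg expRN.
have -> : (1 - (expR (level_pos r))^-1)^-1 = (expR (level_pos r) - 1)^-1 + 1.
  by field; rewrite (gt_eqF p0) (gt_eqF (expR_gt0 _)).
by rewrite lerD2r lef_pV2 ?posrE// lerD2r.
Qed.

(** The density of the Laplace transform L, and the bounds on it from which all
    estimates on L are drawn. *)
Lemma speed_gapP r : 0 < r ->
  [/\ 2 / 3 <= speed_gap r, speed_gap r <= 1, 0 <= speed_gap_rate r,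
      speed_gap_rate r <= 1 / 14 & is_derive r 1 speed_gap (speed_gap_rate r)].
Proof.
move=> r0.
have [] := slope_gap_bounds is_derive_speed_pos is_derive_speed_neg speed_pos_gt1
  speed_neg_gt0 speed_neg_le speed_pos_le speed_pos_large r0.
split => //; apply: is_derive_eq
  (is_derive1B (is_derive_speed_pos r0) (is_derive_speed_neg r0)) _.
by rewrite /speed_gap_rate /gap_rate; ring.
Qed.

End level_sets.

(** * Laplace moments *)

Section laplace_moments.
Context {R : realType}.
Notation mu := (@lebesgue_measure R).
Implicit Types (f : R -> R) (B : set R) (x : R).

Lemma exprn_le_expR n (z : R) : 0 <= z -> z ^+ n <= n`!%:R * expR z.
Proof.
move=> z0; case: n => [|n].
  by rewrite expr0 fact0 mul1r (le_trans _ (expR_ge1Dx z))// lerDl.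
have := expR_ge1Dxn n z0 => H.
rewrite mulrC -ler_pdivrMr ?ltr0n ?fact_gt0//.
by rewrite (le_trans _ H)// lerDr.
Qed.

(** Up to sign, the n-th derivative in [x] of the Laplace integral of e^(-x f). *)
Definition moment B f n x : R :=
  \int[mu]_(u in B) (f u ^+ n * expR (- (x * f u))).

Variables (B : set R) (f : R -> R).
Hypothesis mB : measurable B.
Hypothesis mf : measurable_fun B f.
Hypothesis f_ge0 : forall u, B u -> 0 <= f u.
Hypothesis int_exp : forall x, 0 < x ->
  mu.-integrable B (fun u => (expR (- (x * f u)))%:E).

Lemma measurable_moment n x :
  measurable_fun B (fun u => f u ^+ n * expR (- (x * f u))).
Proof.
apply: measurable_funM; first exact: measurable_funX.
apply: measurableT_comp => //; apply: measurableT_comp => //.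
by apply: measurable_funM => //; exact: measurable_cst.
Qed.

(** Half of the exponent absorbs the power: (x f / 2)^n <= n! e^(x f / 2). *)
Lemma moment_integrable n x : 0 < x ->
  mu.-integrable B (fun u => (f u ^+ n * expR (- (x * f u)))%:E).
Proof.
move=> x0; have x20 : 0 < x / 2 by rewrite divr_gt0.
pose C : R := (2 / x) ^+ n * n`!%:R.
have C0 : 0 <= C by rewrite mulr_ge0// exprn_ge0// divr_ge0// ltW.
have intC : mu.-integrable B (fun u => (C * expR (- (x / 2 * f u)))%:E).
  by under eq_fun do rewrite EFinM; apply: integrableZl => //; exact: int_exp.
apply: le_integrable intC => //.
  by apply/measurable_EFinP; exact: measurable_moment.
move=> u Bu /=; rewrite lee_fin.
have fu := f_ge0 Bu.
rewrite ger0_norm ?mulr_ge0 ?exprn_ge0 ?expR_ge0//.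
rewrite (ger0_norm (mulr_ge0 C0 (expR_ge0 _))).
have -> : - (x * f u) = x / 2 * f u * (-1) + - (x / 2 * f u) by field.
rewrite expRD mulrA ler_wpM2r ?expR_ge0//.
rewrite mulrN1 expRN ler_pdivrMr ?expR_gt0//.
have := @exprn_le_expR n (x / 2 * f u); rewrite mulr_ge0 ?(ltW x20)// => /(_ isT) H.
have -> : f u ^+ n = (2 / x) ^+ n * (x / 2 * f u) ^+ n.
  by rewrite -exprMn; congr (_ ^+ _); field; rewrite gt_eqF.
rewrite /C -[leRHS]mulrA; apply: ler_wpM2l; last exact: H.
by rewrite exprn_ge0// divr_ge0// ltW.
Qed.

(** Differentiation under the integral sign on ]x/2, 2x[, dominated by the next
    moment at x/2. *)
Lemma is_derive_moment n x : 0 < x ->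
  is_derive x 1 (moment B f n) (- moment B f n.+1 x).
Proof.
move=> x0; have x20 : 0 < x / 2 by rewrite divr_gt0.
pose F (y u : R) := f u ^+ n * expR (- (y * f u)).
have dF (y u : R) : is_derive y 1 (F ^~ u) (- (f u ^+ n.+1 * expR (- (y * f u)))).
  apply: is_derive_eq (is_derive1M (is_derive1_cst (f u ^+ n) y)
    (is_derive1_expR (is_derive1N (is_derive1M (is_derive1_id y) (is_derive1_cst (f u) y))))) _.
  by rewrite exprS; ring.
pose G (u : R) := `|f u ^+ n.+1 * expR (- (x / 2 * f u))|.
have I_pos (y : R) : y \in `](x / 2), (x * 2)[ -> 0 < y.
  by rewrite in_itv/= => /andP[/(lt_trans x20)].
have xI : x \in `](x / 2), (x * 2)[ by rewrite in_itv/=; lra.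
have d1F (y u : R) : partial1of2 F y u = - (f u ^+ n.+1 * expR (- (y * f u))).
  by rewrite /partial1of2; exact: is_derive1_derive1 (dF y u).
have H := @cvg_differentiation_under_integral R _ _ mu F B mB x (x / 2) (x * 2) xI
  (fun y yI => moment_integrable n (I_pos _ yI))
  (fun y u _ _ => @ex_derive _ _ _ _ _ _ _ (dF y u)) G
  (fun u => normr_ge0 _).
have intG : mu.-integrable B (EFin \o G).
  exact: integrable_norm (moment_integrable n.+1 x20).
have GB (y u : R) : `](x / 2), (x * 2)[%classic y -> B u -> `|partial1of2 F y u| <= G u.
  rewrite /= in_itv/= => /andP[xy _] Bu; rewrite d1F normrN /G.
  have fu := f_ge0 Bu.
  rewrite !ger0_norm ?mulr_ge0 ?exprn_ge0 ?expR_ge0// ler_wpM2l ?exprn_ge0//.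
  by rewrite ler_expR lerN2 ler_wpM2r// ltW.
have {}H := H intG GB.
have E : \int[mu]_(u in B) partial1of2 F x u = - moment B f n.+1 x.
  rewrite /moment -mulN1r -RintegralZl//; last exact: moment_integrable.
  by apply: eq_Rintegral => u _; rewrite d1F mulN1r.
rewrite E in H.
have H' : h^-1 *: ((moment B f n \o shift x) (h *: 1) - moment B f n x)
    @[h --> 0^'] --> - moment B f n.+1 x.
  under eq_fun do rewrite /= scaler1.
  exact: H.
apply: DeriveDef; first by apply/cvg_ex; eexists; exact: H'.
exact/cvg_lim.
Qed.

Lemma moment_ge0 n x : 0 <= moment B f n x.
Proof.
by apply: Rintegral_ge0 => u Bu; rewrite mulr_ge0 ?expR_ge0// exprn_ge0// f_ge0.
Qed.

End laplace_moments.

(** * Comparison along the level sets *)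

Section level_comparison.
Context {R : realType}.
Notation mu := (@lebesgue_measure R).
Implicit Types (f k psi dpsi : R -> R) (x u r : R).

Local Notation half_line := (@mkset R (fun t => t \in `[0%R, +oo[)).


Lemma continuous_phase : continuous (@phase R).
Proof. by move=> u; exact: is_derive1_continuous (is_derive_phase u). Qed.

Lemma continuous_phaseN : continuous (fun u : R => phase (- u)).
Proof. by move=> u; exact: is_derive1_continuous (is_derive_phaseN u). Qed.

Lemma continuous_exp_phase f x : continuous f -> continuous (fun u => expR (- (x * f u))).
Proof.
move=> cf u; apply: (@continuous_comp _ _ _ (fun u => - (x * f u)) expR);
  last exact: continuous_expR.
by apply: cvgN; apply: cvgMl_tmp; exact: cf.
Qed.

Lemma integrable_expN x : 0 < x ->
  mu.-integrable half_line (fun u => (expR (- (x * u)))%:E).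
Proof.
move=> x0.
pose F (u : R) := - (expR (- (x * u)) / x).
have dF (u : R) : is_derive u 1 F (expR (- (x * u))).
  apply: is_derive_eq (is_derive1N (is_derive1M (is_derive1_expR (is_derive1N
    (is_derive1M (is_derive1_cst x u) (is_derive1_id u)))) (is_derive1_cst x^-1 u))) _.
  by field; rewrite gt_eqF.
have mE : measurable_fun half_line (fun u => expR (- (x * u))).
  apply: measurable_funTS; apply: continuous_measurable_fun.
  by apply: continuous_exp_phase => u; exact: cvg_id.
apply/integrableP; split; first exact/measurable_EFinP.
under eq_integral do rewrite /= ger0_norm ?expR_ge0//.
rewrite (@ge0_continuous_FTC2y _ _ F 0 0).
- by rewrite -EFinB ltry.
- by move=> u _; exact: expR_ge0.
- by apply: continuous_subspaceT; apply: continuous_exp_phase => u; exact: cvg_id.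
- rewrite -[X in _ --> X]oppr0; apply: cvgN.
  rewrite -(mul0r x^-1); apply: cvgMr_tmp.
  apply: (cvg_comp (fun u : R => x * u) (fun z => expR (- z))); last exact: cvgr_expR.
  exact: gt0_cvgMry.
- by move=> u _; case: (dF u).
- by apply: cvg_at_right_filter; exact: is_derive1_continuous (dF 0).
- by move=> u _; exact: is_derive1_derive1 (dF u).
Qed.

(** Linear growth suffices, by comparison with e^(x - x u). *)
Lemma integrable_exp_growth f x : 0 < x -> continuous f ->
    (forall u, 0 <= u -> u - 1 <= f u) ->
  mu.-integrable half_line (fun u => (expR (- (x * f u)))%:E).
Proof.
move=> x0 cf fu.
have : mu.-integrable half_line (fun u => (expR x * expR (- (x * u)))%:E).
  exact: (integrableZl _ (expR x) (integrable_expN x0)).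
apply: le_integrable => //.
  apply/measurable_EFinP/measurable_funTS; apply: continuous_measurable_fun.
  exact: continuous_exp_phase.
move=> u; rewrite /= in_itv/= andbT => u0; rewrite lee_fin.
rewrite !ger0_norm ?mulr_ge0 ?expR_ge0// -expRD ler_expR.
by have := fu _ u0; nra.
Qed.

Lemma cvg_integral_initial f (y : R^nat) :
    mu.-integrable half_line (EFin \o f) -> y n @[n --> \oo] --> +oo ->
  \int[mu]_(u in `[0%R, y n]) f u @[n --> \oo] --> \int[mu]_(u in half_line) f u.
Proof.
move=> intf yoo.
have mD : measurable half_line by [].
pose fn (n : nat) (u : R) := (f \_ `]-oo, y n]) u.
have E n : \int[mu]_(u in `[0%R, y n]) f u = \int[mu]_(u in half_line) fn n u.
  rewrite /fn -Rintegral_mkcondr; congr (Rintegral _ _ _).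
  apply/seteqP; split => u /=; rewrite !in_itv/= ?andbT.
    by move=> /andP.
  by move=> [-> ->].
under eq_fun do rewrite E.
have mf : measurable_fun half_line f by apply/measurable_EFinP; case/integrableP: intf.
apply: fine_cvg; rewrite /Rintegral fineK; last exact: integrable_fin_num.
apply: (@dominated_cvg _ _ _ mu half_line mD (fun n u => (fn n u)%:E) (EFin \o f)
  (fun u => `|f u|%:E)).
- move=> n; apply/measurable_EFinP; rewrite /fn.
  apply/measurable_restrict => //.
  by apply: measurable_funS mf => //; exact: subIsetl.
- move=> u _; apply: cvg_EFin; first exact: nearW.
  apply: cvg_near_cst.
  have /cvgryPge/(_ u) := yoo.
  apply: filterS => n uyn; rewrite /= /fn patchE ifT// inE/=.
  by rewrite in_itv.
- by [].
- exact: (integrable_norm intf).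
- move=> n u _; rewrite /= lee_fin /fn patchE.
  by case: ifP; rewrite ?normr0.
Qed.

Lemma cvg_integral_initial0 f (y : R^nat) :
    mu.-integrable half_line (EFin \o f) -> (forall n, 0 <= y n) -> y n @[n --> \oo] --> 0 ->
  \int[mu]_(u in `[0%R, y n]) f u @[n --> \oo] --> 0.
Proof.
move=> intf y0 yoo.
have int1 : mu.-integrable `[0%R, 1] (EFin \o f).
  by apply: integrableS intf => //; exact: subset_itvl.
have := parameterized_integral_cvg_left ltr01 int1.
move=> H.
exact: (cvg_comp y (fun x => parameterized_integral mu 0 x f) yoo H).
Qed.

Lemma is_derive_initial f u : mu.-integrable half_line (EFin \o f) ->
    continuous f -> 0 < u ->
  is_derive u 1 (fun y => \int[mu]_(t in `[0%R, y]) f t) (f u).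
Proof.
move=> intf cf u0.
have [||||d e] := @continuous_FTC1_closed R f 0 u (u + 1).
- by rewrite ltrDl.
- by apply: integrableS intf => //; exact: subset_itvl.
- exact: u0.
- exact: cf.
by apply: DeriveDef => //; rewrite -derive1E.
Qed.

(** Follow both integrals along the levels: the derivative in r of the integral of
    k(h(u)) over [0, a(r)] minus that of k(h(-u)) over [0, b(r)] is k(r) rho(r).
    Integrating an upper bound psi' of it from 0 to +oo gives the claim. This takes
    the place of the change of variables r = h(u), whose jacobian is singular at 0. *)
Lemma level_comparison k psi dpsi (p0 p1 : R) :
    continuous k ->
    mu.-integrable half_line (fun u => (k (phase u))%:E) ->
    mu.-integrable half_line (fun u => (k (phase (- u)))%:E) ->
    (forall r, 0 < r -> is_derive r 1 psi (dpsi r)) ->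
    (forall r, 0 < r -> k r * speed_gap r <= dpsi r) ->
    psi r @[r --> 0^'+] --> p0 -> psi r @[r --> +oo] --> p1 ->
  \int[mu]_(u in half_line) k (phase u) - \int[mu]_(u in half_line) k (phase (- u))
    <= p1 - p0.
Proof.
move=> ck intp intn dpsiP kpsi cvg0 cvg1.
have ckp : continuous (fun u => k (phase u)).
  by move=> u; apply: continuous_comp; [exact: continuous_phase|exact: ck].
have ckn : continuous (fun u => k (phase (- u))).
  by move=> u; apply: (@continuous_comp _ _ _ (fun u => phase (- u)));
    [exact: continuous_phaseN|exact: ck].
pose Fp (y : R) := \int[mu]_(u in `[0%R, y]) k (phase u).
pose Fn (y : R) := \int[mu]_(u in `[0%R, y]) k (phase (- u)).
pose g (r : R) := psi r - (Fp (level_pos r) - Fn (level_neg r)).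
have g_incr s t : 0 < s -> s <= t -> g s <= g t.
  move=> s0 st; apply: (@ge0_is_derive1_le _ g (fun r => dpsi r - k r * speed_gap r)) => // r /andP[sr _];
    have r0 := lt_le_trans s0 sr; last by rewrite subr_ge0 kpsi.
  have [a0 b0 pa pb [da db]] := levelP r0.
  have dp := is_derive1_comp (is_derive_initial intp ckp a0) da.
  have dn := is_derive1_comp (is_derive_initial intn ckn b0) db.
  apply: is_derive_eq (is_derive1B (dpsiP _ r0) (is_derive1B dp dn)) _.
  by rewrite pa pb /speed_gap /speed_pos /speed_neg; ring.
(* Levels tending to 0 and to +oo along which both endpoints are under control: the
   right endpoint is e n at level s n, the left one is n + 1 at level t n, and in
   each case the other endpoint is handled by b <= a. *)
pose e n : R := n.+1%:R^-1.
have e0 n : 0 < e n by rewrite invr_gt0 ltr0n.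
pose s n : R := phase (e n).
pose t n : R := phase (- n.+1%:R).
have phase_gt0 u : 0 < u -> 0 < phase u.
  by move=> u0; rewrite -(phase0 (R := R)); exact: phase_lt.
have s0 n : 0 < s n by exact: phase_gt0.
have t0 n : 0 < t n.
  by apply: lt_le_trans (phase_leN _) => //; exact: phase_gt0.
have phase_inj u v : 0 < u -> 0 < v -> phase u = phase v -> u = v.
  have lem (a b : R) : 0 < a -> a < b -> phase a < phase b by move=> /ltW; exact: phase_lt.
  move=> u0 v0 uv; have [/(lem _ _ u0)|/(lem _ _ v0)|//] := ltgtP u v; by rewrite uv ltxx.
have phaseN_inj u v : 0 < u -> 0 < v -> phase (- u) = phase (- v) -> u = v.
  have lem (a b : R) : 0 < a -> a < b -> phase (- a) < phase (- b).
    by move=> /ltW; exact: phaseN_lt.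
  move=> u0 v0 uv; have [/(lem _ _ u0)|/(lem _ _ v0)|//] := ltgtP u v; by rewrite uv ltxx.
have as_ n : level_pos (s n) = e n.
  by have [a0 _ pa _ _] := levelP (s0 n); exact: phase_inj.
have bs n : 0 <= level_neg (s n) <= e n.
  have [_ b0 _ _ _] := levelP (s0 n); rewrite ltW//=.
  by rewrite -as_ level_neg_le.
have bt n : level_neg (t n) = n.+1%:R.
  by have [_ b0 _ pb _] := levelP (t0 n); exact: phaseN_inj.
have at_ n : n.+1%:R <= level_pos (t n).
  by rewrite -bt level_neg_le.
have e_cvg : e n @[n --> \oo] --> 0 by exact: cvg_harmonic.
have s_cvg : s n @[n --> \oo] --> 0.
  rewrite -(phase0 (R := R)).
  by apply: (cvg_comp e phase e_cvg); exact: continuous_phase.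
have S_oo : n.+1%:R @[n --> \oo] --> (+oo : set_system R).
  by have := @cvgr_idn R; rewrite -cvg_shiftS.
have t_cvg : t n @[n --> \oo] --> +oo.
  apply: (@ger_cvgy _ _ _ _ (fun n => n%:R)); last exact: cvgr_idn.
  apply: nearW => n; apply: le_trans (phase_geNB1 _) => //.
  by rewrite -natr1 addrK.
have Gs : g (s n) @[n --> \oo] --> p0.
  rewrite -[p0]subr0; apply: cvgB.
    by move/cvg_at_rightP : cvg0; apply.
  rewrite -(subr0 0); apply: cvgB.
    apply: (@cvg_integral_initial0 (fun u => k (phase u)) (fun n => level_pos (s n)) intp)
      => [n|]; first by rewrite as_ ltW.
    by under eq_fun do rewrite as_.
  apply: (@cvg_integral_initial0 (fun u => k (phase (- u))) (fun n => level_neg (s n)) intn)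
    => [n|]; first by have /andP[] := bs n.
  apply: (@squeeze_cvgr _ _ _ _ (cst 0) e) => //; first exact: nearW.
  exact: cvg_cst.
have Gt : g (t n) @[n --> \oo] -->
    p1 - (\int[mu]_(u in half_line) k (phase u) - \int[mu]_(u in half_line) k (phase (- u))).
  apply: cvgB.
    by move/cvg_pinftyP : cvg1; apply.
  apply: cvgB.
    apply: (@cvg_integral_initial (fun u => k (phase u)) (fun n => level_pos (t n)) intp).
    apply: (@ger_cvgy _ _ _ _ (fun n => n.+1%:R)) => //.
    exact: nearW.
  apply: (@cvg_integral_initial (fun u => k (phase (- u))) (fun n => level_neg (t n)) intn).
  by under eq_fun do rewrite bt.
rewrite lerBrDl addrC -lerBrDl.
apply: (ler_cvg_to Gs Gt); apply: nearW => n /=; apply: g_incr => //.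
apply: le_trans (phase_leN _) => //.
apply: phase_le_mono; first exact: ltW.
by apply: (@le_trans _ _ 1); rewrite ?invf_le1 ?ler1n.
Qed.

End level_comparison.

(** * Bounds on the difference of the two half-line integrals *)

Section half_line_gap.
Context {R : realType}.
Notation mu := (@lebesgue_measure R).
Implicit Types (f : R -> R) (x u r c : R).

Local Notation half_line := (@mkset R (fun t => t \in `[0%R, +oo[)).


(** Up to sign, the n-th derivative of L. *)
Definition side_gap n x : R :=
  moment half_line phase n x - moment half_line (fun u => phase (- u)) n x.

Let int_pos x : 0 < x -> mu.-integrable half_line (fun u => (expR (- (x * phase u)))%:E).
Proof.
move=> x0; apply: integrable_exp_growth => //; first exact: continuous_phase.
by move=> u _; exact: phase_geB1.
Qed.

Let int_neg x : 0 < x -> mu.-integrable half_line (fun u => (expR (- (x * phase (- u))))%:E).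
Proof.
move=> x0; apply: (@integrable_exp_growth _ (fun u => phase (- u))) => //.
  exact: continuous_phaseN.
exact: phase_geNB1.
Qed.

Let meas_pos : measurable_fun half_line (@phase R).
Proof. apply: measurable_funTS; apply: continuous_measurable_fun; exact: continuous_phase. Qed.

Let meas_neg : measurable_fun half_line (fun u : R => phase (- u)).
Proof. apply: measurable_funTS; apply: continuous_measurable_fun; exact: continuous_phaseN. Qed.

Lemma is_derive_side_gap n x : 0 < x ->
  is_derive x 1 (side_gap n) (- side_gap n.+1 x).
Proof.
move=> x0; apply: is_derive_eq.
  apply: is_derive1B.
    by apply: is_derive_moment => // u _; exact: phase_ge0.
  by apply: (@is_derive_moment _ _ (fun u => phase (- u))) => // u _; exact: phase_ge0.
by rewrite /side_gap opprB opprK addrC.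
Qed.

(** The kernels needed for L, (x L)' and (x L)'' as functions of the level. *)
Definition quad_exp c0 c1 c2 x r : R := (c0 + c1 * r + c2 * r ^+ 2) * expR (- (x * r)).

Let quad_exp_moments f c0 c1 c2 x : 0 < x ->
    measurable_fun half_line f -> (forall u, 0 <= f u) ->
    (forall x, 0 < x -> mu.-integrable half_line (fun u => (expR (- (x * f u)))%:E)) ->
  mu.-integrable half_line (fun u => (quad_exp c0 c1 c2 x (f u))%:E) /\
  \int[mu]_(u in half_line) quad_exp c0 c1 c2 x (f u) =
  c0 * moment half_line f 0 x + c1 * moment half_line f 1 x + c2 * moment half_line f 2 x.
Proof.
move=> x0 mf f0 intf.
have mD : measurable half_line by [].
have int n := @moment_integrable _ _ f mD mf (fun u _ => f0 u) intf n x x0.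
have intZ n c : mu.-integrable half_line (fun u => (c * (f u ^+ n * expR (- (x * f u))))%:E).
  by apply: (integrableZl _ c (int n)).
have E u : quad_exp c0 c1 c2 x (f u) =
    c0 * (f u ^+ 0 * expR (- (x * f u))) + c1 * (f u ^+ 1 * expR (- (x * f u)))
    + c2 * (f u ^+ 2 * expR (- (x * f u))).
  by rewrite /quad_exp; ring.
have intD g1 g2 : mu.-integrable half_line (fun u => (g1 u)%:E) ->
    mu.-integrable half_line (fun u => (g2 u)%:E) ->
    mu.-integrable half_line (fun u => (g1 u + g2 u)%:E).
  by move=> i1 i2; apply: (integrableD _ i1 i2).
have int01 := intD _ _ (intZ 0 c0) (intZ 1 c1).
have int012 := intD _ _ int01 (intZ 2 c2).
split.
  apply: (eq_ind_r (fun F => mu.-integrable half_line F) int012).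
  by apply/funext => u; rewrite -E.
transitivity (\int[mu]_(u in half_line) (c0 * (f u ^+ 0 * expR (- (x * f u))) +
    c1 * (f u ^+ 1 * expR (- (x * f u))) + c2 * (f u ^+ 2 * expR (- (x * f u))))).
  by apply: eq_Rintegral => u _; exact: E.
have ID g1 g2 : mu.-integrable half_line (fun u => (g1 u)%:E) ->
    mu.-integrable half_line (fun u => (g2 u)%:E) ->
    \int[mu]_(u in half_line) (g1 u + g2 u) =
    \int[mu]_(u in half_line) g1 u + \int[mu]_(u in half_line) g2 u.
  by move=> i1 i2; apply: (RintegralD _ i1 i2).
have IZ n c : \int[mu]_(u in half_line) (c * (f u ^+ n * expR (- (x * f u)))) =
    c * moment half_line f n x.
  by apply: (RintegralZl _ _ (int n)).
by rewrite (ID _ _ int01 (intZ 2 c2)) (ID _ _ (intZ 0 c0) (intZ 1 c1)) !IZ.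

Qed.

(** [level_comparison] for the kernels above. For (x L)' and
    (x L)'' the function psi is built on K rho, K a primitive of the kernel: its
    derivative is the kernel times rho plus K rho', and the sign or the size of rho'
    does the rest. *)
Lemma side_gap_comparison psi dpsi c0 c1 c2 x (p0 p1 : R) : 0 < x ->
    (forall r, 0 < r -> is_derive r 1 psi (dpsi r)) ->
    (forall r, 0 < r -> quad_exp c0 c1 c2 x r * speed_gap r <= dpsi r) ->
    psi r @[r --> 0^'+] --> p0 -> psi r @[r --> +oo] --> p1 ->
  c0 * side_gap 0 x + c1 * side_gap 1 x + c2 * side_gap 2 x <= p1 - p0.
Proof.
move=> x0 dpsiP H cvg0 cvg1.
have [ip ep] := quad_exp_moments c0 c1 c2 x0 meas_pos phase_ge0 int_pos.
have [im em] := quad_exp_moments c0 c1 c2 x0 meas_neg (fun u => phase_ge0 (- u)) int_neg.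
have ck : continuous (quad_exp c0 c1 c2 x).
  move=> r; exact: (is_derive1_continuous (is_derive1M (is_derive1D (is_derive1D
    (is_derive1_cst c0 r) (is_derive1M (is_derive1_cst c1 r) (is_derive1_id r)))
    (is_derive1M (is_derive1_cst c2 r) (is_derive1X 2 (is_derive1_id r))))
    (is_derive1_expR (is_derive1N (is_derive1M (is_derive1_cst x r) (is_derive1_id r)))))).
have := level_comparison ck ip im dpsiP H cvg0 cvg1.
rewrite ep em /side_gap.
move=> le; apply: le_trans le; rewrite le_eqVlt; apply/orP; left; apply/eqP.
by do 6 (move: (moment _ _ _ _) => ?); ring.
Qed.

Lemma is_derive_expN x r : is_derive r 1 (fun r => expR (- (x * r))) (- x * expR (- (x * r))).
Proof.
apply: is_derive_eq (is_derive1_expR (is_derive1N (is_derive1M (is_derive1_cst x r) (is_derive1_id r)))) _.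
by ring.
Qed.

Lemma cvg_exprn_expN n x : 0 < x -> r ^+ n * expR (- (x * r)) @[r --> +oo] --> (0 : R).
Proof.
move=> x0; pose C : R := n.+1`!%:R / x ^+ n.+1.
apply: (@squeeze_cvgr _ _ _ _ (cst 0) (fun r => C * r^-1)).
- near=> r; have r0 : 0 < r by near: r; exact: nbhs_pinfty_gt.
  rewrite mulr_ge0 ?exprn_ge0 ?expR_ge0 ?(ltW r0)//=.
  rewrite expRN ler_pdivrMr ?expR_gt0//.
  have := @exprn_le_expR R n.+1 (x * r); rewrite mulr_ge0 ?(ltW x0) ?(ltW r0)// => /(_ isT) H.
  rewrite -(ler_pM2r (mulr_gt0 (exprn_gt0 n.+1 x0) r0)).
  rewrite mulrCA -[r ^+ n * r]exprSr -exprMn; apply: (le_trans H).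
  rewrite le_eqVlt; apply/orP; left; apply/eqP.
  by rewrite /C; field; rewrite !gt_eqF ?exprn_gt0.
- exact: cvg_cst.
- rewrite -(mulr0 C); apply: cvgMl_tmp.
  apply/(@gtr0_cvgV0 _ _ _ _ id); last exact: cvg_id.
  by near=> r; near: r; exact: nbhs_pinfty_gt.
Unshelve. all: by end_near. Qed.

(** From rho <= 1. *)
Lemma gap_upper x : 0 < x -> x * side_gap 0 x <= 1.
Proof.
move=> x0.
have := @side_gap_comparison (fun r => - expR (- (x * r))) (fun r => x * expR (- (x * r)))
  x 0 0 x (- 1) 0 x0.
rewrite !mul0r !addr0 sub0r opprK; apply.
- by move=> r r0; apply: is_derive_eq (is_derive1N (is_derive_expN x r)) _; ring.
- move=> r r0; have [_ d1 _ _ _] := speed_gapP r0.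
  by rewrite /quad_exp !mul0r !addr0 ler_piMr// mulr_ge0 ?expR_ge0 ?(ltW x0).
- apply: cvg_at_right_filter.
  have := is_derive1_continuous (is_derive1N (is_derive_expN x 0)).
  by rewrite /prop_for /continuous_at /= mulr0 oppr0 expR0.
- rewrite -oppr0; apply: cvgN; have := cvg_exprn_expN 0 x0.
  by under eq_fun do rewrite expr0 mul1r.
Qed.

(** From rho >= 2/3. *)
Lemma gap_lower x : 0 < x -> 2 / 3 <= x * side_gap 0 x.
Proof.
move=> x0.
have := @side_gap_comparison (fun r => 2 / 3 * expR (- (x * r)))
  (fun r => - x * (2 / 3 * expR (- (x * r)))) (- x) 0 0 x (2 / 3) 0 x0.
rewrite !mul0r !addr0 sub0r mulNr lerN2; apply.
- move=> r r0; apply: is_derive_eq (is_derive1M (is_derive1_cst (2 / 3) r) (is_derive_expN x r)) _; ring.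
- move=> r r0; have [d23 _ _ _ _] := speed_gapP r0.
  rewrite -subr_ge0 (_ : _ - _ = x * expR (- (x * r)) * (speed_gap r - 2 / 3)).
    by rewrite mulr_ge0 ?subr_ge0// mulr_ge0 ?expR_ge0// ltW.
  by rewrite /quad_exp; ring.
- apply: cvg_at_right_filter.
  have := is_derive1_continuous (is_derive1M (is_derive1_cst (2 / 3) 0) (is_derive_expN x 0)).
  by rewrite /prop_for /continuous_at /= mulr0 oppr0 expR0 mulr1.
- rewrite -(mulr0 (2 / 3)); apply: cvgMl_tmp; have := cvg_exprn_expN 0 x0.
  by under eq_fun do rewrite expr0 mul1r.
Qed.

Let speed_gap_weight n x r : 0 < r ->
  0 <= r ^+ n * expR (- (x * r)) * speed_gap r <= r ^+ n * expR (- (x * r)).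
Proof.
move=> r0; have [d23 d1 _ _ _] := speed_gapP r0.
have w0 : 0 <= r ^+ n * expR (- (x * r)) by rewrite mulr_ge0 ?exprn_ge0 ?expR_ge0// ltW.
rewrite ler_piMr// andbT mulr_ge0//; lra.
Qed.

Let cvg_weight_pinfty n x : 0 < x ->
  r ^+ n * expR (- (x * r)) * speed_gap r @[r --> +oo] --> (0 : R).
Proof.
move=> x0.
apply: (@squeeze_cvgr _ _ _ _ (cst 0) (fun r => r ^+ n * expR (- (x * r)))).
- near=> r; apply: speed_gap_weight; near: r; exact: nbhs_pinfty_gt.
- exact: cvg_cst.
- exact: cvg_exprn_expN.
Unshelve. all: by end_near. Qed.

Let cvg_weight_zero n x : r ^+ n.+1 * expR (- (x * r)) * speed_gap r @[r --> 0^'+] --> (0 : R).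
Proof.
apply: (@squeeze_cvgr _ _ _ _ (cst 0) (fun r => r ^+ n.+1 * expR (- (x * r)))).
- by near=> r; apply: speed_gap_weight.
- exact: cvg_cst.
- apply: cvg_at_right_filter.
  have := is_derive1_continuous (is_derive1M (is_derive1X n.+1 (is_derive1_id 0)) (is_derive_expN x 0)).
  by rewrite /prop_for /continuous_at /= expr0n mul0r.
Unshelve. all: by end_near. Qed.

(** The left side is (x L)'. Its kernel has primitive r e^(-x r) >= 0, and
    rho' >= 0. *)
Lemma gap_decreasing x : 0 < x -> side_gap 0 x - x * side_gap 1 x <= 0.
Proof.
move=> x0.
have := @side_gap_comparison (fun r => r ^+ 1 * expR (- (x * r)) * speed_gap r)
  (fun r => (1 - x * r) * expR (- (x * r)) * speed_gap r + r * expR (- (x * r)) * speed_gap_rate r)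
  1 (- x) 0 x 0 0 x0.
rewrite mul0r addr0 mul1r mulNr subr0; apply.
- move=> r r0; have [_ _ _ _ dd] := speed_gapP r0.
  apply: is_derive_eq (is_derive1M (is_derive1M (is_derive1X 1 (is_derive1_id r)) (is_derive_expN x r)) dd) _.
  by rewrite /=; ring.
- move=> r r0; have [_ _ w0 _ _] := speed_gapP r0.
  rewrite /quad_exp mul0r addr0 mulNr lerDl !mulr_ge0 ?expR_ge0// ltW//.
- exact: cvg_weight_zero.
- exact: cvg_weight_pinfty.
Qed.

(** The left side is (x L)''. Its kernel has primitive - r^2 e^(-x r), so that it is
    bounded by the integral of r^2 e^(-x r) rho', and rho' <= 1/14. *)
Lemma gap_curvature x : 0 < x ->
  x * side_gap 2 x - 2 * side_gap 1 x <= 1 / 7 / x ^+ 3.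
Proof.
move=> x0.
(* Minus the primitive of r^2 e^(-x r) which vanishes at +oo. *)
pose N r := (r ^+ 2 / x + 2 * r / x ^+ 2 + 2 / x ^+ 3) * expR (- (x * r)).
have dN r : is_derive r 1 N (- (r ^+ 2 * expR (- (x * r)))).
  apply: is_derive_eq (is_derive1M (is_derive1D (is_derive1D
    (is_derive1M (is_derive1X 2 (is_derive1_id r)) (is_derive1_cst x^-1 r))
    (is_derive1M (is_derive1M (is_derive1_cst 2 r) (is_derive1_id r)) (is_derive1_cst (x ^+ 2)^-1 r)))
    (is_derive1_cst (2 / x ^+ 3) r)) (is_derive_expN x r)) _.
  by rewrite /=; field; rewrite gt_eqF.
have := @side_gap_comparison (fun r => - (r ^+ 2 * expR (- (x * r)) * speed_gap r) - 1 / 14 * N r)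
  (fun r => (x * r ^+ 2 - 2 * r) * expR (- (x * r)) * speed_gap r
     + (1 / 14 - speed_gap_rate r) * (r ^+ 2 * expR (- (x * r))))
  0 (- 2) x x (0 - 1 / 14 * (2 / x ^+ 3)) 0 x0.
have -> : 0 - (0 - 1 / 14 * (2 / x ^+ 3)) = 1 / 7 / x ^+ 3 by field; rewrite gt_eqF.
have -> : 0 * side_gap 0 x + - 2 * side_gap 1 x + x * side_gap 2 x =
  x * side_gap 2 x - 2 * side_gap 1 x by rewrite mul0r add0r mulNr addrC.
apply.
- move=> r r0; have [_ _ _ _ dd] := speed_gapP r0.
  apply: is_derive_eq (is_derive1B (is_derive1N (is_derive1M (is_derive1M
    (is_derive1X 2 (is_derive1_id r)) (is_derive_expN x r)) dd))
    (is_derive1M (is_derive1_cst (1 / 14) r) (dN r))) _.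
  by rewrite /=; field.
- move=> r r0; have [_ _ _ w1 _] := speed_gapP r0.
  have -> : quad_exp 0 (- 2) x x r = (x * r ^+ 2 - 2 * r) * expR (- (x * r)).
    by rewrite /quad_exp; ring.
  by rewrite lerDl !mulr_ge0 ?expR_ge0 ?exprn_ge0 ?subr_ge0// ltW.
- apply: cvgB.
    by rewrite -[X in _ --> X]oppr0; apply: cvgN; exact: cvg_weight_zero.
  apply: cvgMl_tmp; apply: cvg_at_right_filter.
  have := is_derive1_continuous (dN 0).
  by rewrite /prop_for /continuous_at /= /N expr0n mulr0 !mul0r !add0r mulr0 oppr0 expR0 mulr1.
- rewrite -[X in _ --> X](subr0 0); apply: cvgB.
    by rewrite -[X in _ --> X]oppr0; apply: cvgN; exact: cvg_weight_pinfty.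
  rewrite -(mulr0 (1 / 14)); apply: cvgMl_tmp.
  have -> : N = (fun r => x^-1 * (r ^+ 2 * expR (- (x * r))) +
      2 / x ^+ 2 * (r ^+ 1 * expR (- (x * r))) + 2 / x ^+ 3 * (r ^+ 0 * expR (- (x * r)))).
    by apply/funext => r; rewrite /N; field; rewrite gt_eqF.
  rewrite -[X in _ --> X](addr0 0); apply: cvgD; last first.
    by rewrite -(mulr0 (2 / x ^+ 3)); apply: cvgMl_tmp; exact: cvg_exprn_expN.
  rewrite -[X in _ --> X](addr0 0); apply: cvgD.
    by rewrite -(mulr0 x^-1); apply: cvgMl_tmp; exact: cvg_exprn_expN.
  by rewrite -(mulr0 (2 / x ^+ 2)); apply: cvgMl_tmp; exact: cvg_exprn_expN.
Qed.

End half_line_gap.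

(** * The logarithmic ratio as an implicit function *)

Section implicit_solution.
Context {R : realType}.
Notation mu := (@lebesgue_measure R).
Implicit Types (f g G : R -> R) (a b c x y z u : R).

Local Notation half_line := (@mkset R (fun t => t \in `[0%R, +oo[)).

(** Caratheodory's criterion, with the factorisation required only near [x]. *)
Lemma local_caratheodory f g x a : (\forall z \near x, f z - f x = g z * (z - x)) ->
  {for x, continuous g} -> g x = a -> is_derive x 1 f a.
Proof.
move=> fg cg gx; apply/is_derive1_caratheodory.
pose g' z := if z == x then a else (f z - f x) / (z - x).
exists g'; split.
- move=> z; rewrite /g'; case: eqP => [->|/eqP]; first by rewrite !subrr mulr0.
  by rewrite -subr_eq0 => /divfK ->.
- rewrite /prop_for /continuous_at {2}/g' eqxx -gx.
  apply: cvg_trans cg; apply: near_eq_cvg; near=> z.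
  rewrite /g'; case: eqP => [->//|/eqP zx].
  have -> : f z - f x = g z * (z - x) by near: z.
  by rewrite mulfK// subr_eq0.
- by rewrite /g' eqxx.
Unshelve. all: by end_near. Qed.

Lemma for_continuousM f g x : {for x, continuous f} -> {for x, continuous g} ->
  {for x, continuous (fun z => f z * g z)}.
Proof. exact: continuousM. Qed.

Lemma for_continuousD f g x : {for x, continuous f} -> {for x, continuous g} ->
  {for x, continuous (fun z => f z + g z)}.
Proof. exact: continuousD. Qed.

Lemma for_continuous_expR f x : {for x, continuous f} -> {for x, continuous (fun z => expR (f z))}.
Proof. by move=> cf; apply: continuous_comp => //; exact: continuous_expR. Qed.

(** Comparison of an integral with a primitive; the derivatives are compared in
    the interior only, where the integral is differentiable in its endpoint. *)
Lemma initial_ge f G g y : 0 <= y -> continuous f ->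
    (forall u, is_derive u 1 G (g u)) -> (forall u, 0 < u < y -> g u <= f u) ->
  G y - G 0 <= \int[mu]_(u in `[0, y]) f u.
Proof.
rewrite le_eqVlt => /predU1P[<- _ _ _|y0 cf dG gf].
  by rewrite subrr set_itv1 Rintegral_set1.
have intf b : mu.-integrable `[0, b] (EFin \o f).
  by apply: continuous_compact_integrable; [exact: segment_compact|exact: continuous_subspaceT].
pose I z := \int[mu]_(u in `[0, z]) f u.
have dI c : 0 < c -> is_derive c 1 I (f c).
  move=> c0; have [||||d e] := @continuous_FTC1_closed R f 0 c (c + 1);
    [by rewrite ltrDl|exact: intf|exact: c0|exact: cf|].
  by apply: (DeriveDef d); rewrite -derive1E.
have cI : {within `[0, y], continuous I}.
  exact: parameterized_integral_continuous (ltW y0) (intf y).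
have cG : {within `[0, y], continuous G}.
  by apply: (is_derive1_within (df := g)) => u _; exact: dG.
have [c c0y|z|c] := @MVT _ (fun z => I z - G z) (fun u => f u - g u) 0 y y0.
- by apply: (is_derive1B (dI _ _) (dG c)); move: c0y; rewrite in_itv/= => /andP[].
- exact: (@continuousB _ _ (subspace `[0, y]) I G z (cI z) (cG z)).
rewrite in_itv/= => c0y; rewrite /I set_itv1 Rintegral_set1 sub0r opprK subr0 => H.
have : 0 <= (f c - g c) * y by rewrite mulr_ge0 ?(ltW y0)// subr_ge0 gf.
by rewrite -H -addrA [- G y + _]addrC -opprB subr_ge0.
Qed.

Lemma initial_le f G g y : 0 <= y -> continuous f ->
    (forall u, is_derive u 1 G (g u)) -> (forall u, 0 < u < y -> f u <= g u) ->
  \int[mu]_(u in `[0, y]) f u <= G y - G 0.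
Proof.
move=> y0 cf dG fg.
have intf : mu.-integrable `[0, y] (EFin \o f).
  by apply: continuous_compact_integrable; [exact: segment_compact|exact: continuous_subspaceT].
have := @initial_ge (fun u => - f u) (fun u => - G u) (fun u => - g u) y y0.
have -> : \int[mu]_(u in `[0, y]) (- f u) = - \int[mu]_(u in `[0, y]) f u.
  rewrite -mulN1r -RintegralZl//; apply: eq_Rintegral => u _; by rewrite mulN1r.
move=> H; rewrite -lerN2 opprB addrC -[G 0]opprK.
apply: H => //.
- by move=> u; apply: cvgN; exact: cf.
- by move=> u /fg; rewrite lerN2.
Qed.

Definition partial_moment n x y : R := moment `[0, y] phase n x.

Lemma continuous_moment_integrand n x :
  continuous (fun u : R => phase u ^+ n * expR (- (x * phase u))).
Proof.
move=> u; exact: (is_derive1_continuous (is_derive1M (is_derive1X n (is_derive_phase u))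
  (is_derive1_expR (is_derive1N (is_derive1M (is_derive1_cst x u) (is_derive_phase u)))))).
Qed.

Lemma is_derive_partial_moment_l n x y : 0 < x ->
  is_derive x 1 (partial_moment n ^~ y) (- partial_moment n.+1 x y).
Proof.
move=> x0; apply: is_derive_moment => //.
- by apply: measurable_funTS; apply: continuous_measurable_fun; exact: continuous_phase.
- by move=> u _; exact: phase_ge0.
- move=> z z0; apply: continuous_compact_integrable; first exact: segment_compact.
  by apply: continuous_subspaceT; apply: continuous_exp_phase; exact: continuous_phase.
Qed.

Lemma is_derive_partial_moment_r n x y : 0 < x -> 0 < y ->
  is_derive y 1 (partial_moment n x) (phase y ^+ n * expR (- (x * phase y))).
Proof.
move=> x0 y0; apply: (@is_derive_initial _ (fun u => phase u ^+ n * expR (- (x * phase u)))) => //.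
  apply: (@moment_integrable _ half_line phase) => //.
  - by apply: measurable_funTS; apply: continuous_measurable_fun; exact: continuous_phase.
  - by move=> u _; exact: phase_ge0.
  - move=> z z0; apply: integrable_exp_growth => //; first exact: continuous_phase.
    by move=> u _; exact: phase_geB1.
exact: continuous_moment_integrand.
Qed.

Lemma partial_moment_ge0 n x y : 0 <= partial_moment n x y.
Proof. by apply: moment_ge0 => u _; exact: phase_ge0. Qed.

Lemma partial_moment0_le x y : 0 < x -> 0 <= y -> partial_moment 0 x y <= y.
Proof.
move=> x0 y0; rewrite -[leRHS]subr0.
apply: (@initial_le _ id (fun=> 1)) => // [|u _]; first exact: continuous_moment_integrand.
by rewrite expr0 mul1r expR_le1 oppr_le0 mulr_ge0 ?phase_ge0// ltW.
Qed.

Lemma partial_moment0_ge x y : 0 < x -> 0 <= y ->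
  1 - expR (- (x * y)) <= x * partial_moment 0 x y.
Proof.
move=> x0 y0; rewrite -ler_pdivrMl//.
pose G u := - (expR (- (x * u)) / x).
have -> : x^-1 * (1 - expR (- (x * y))) = G y - G 0.
  by rewrite /G mulr0 oppr0 expR0; ring.
apply: (@initial_ge _ G (fun u => expR (- (x * u)))) => // [|u|u /andP[u0 _]].
- exact: continuous_moment_integrand.
- apply: is_derive_eq (is_derive1N (is_derive1M (is_derive_expN x u) (is_derive1_cst x^-1 u))) _.
  by field; rewrite gt_eqF.
- rewrite expr0 mul1r ler_expR lerN2 ler_wpM2l ?(ltW x0)//.
  exact: phase_le (ltW u0).
Qed.

(** As long as x h <= 1, the integrand h e^(-x h) increases up to the endpoint. *)
Lemma partial_moment1_le x y : 0 < x -> 0 <= y -> x * phase y <= 1 ->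
  partial_moment 1 x y <= y * (phase y * expR (- (x * phase y))).
Proof.
move=> x0 y0 xy1; set K := phase y * _.
have -> : y * K = y * K - 0 * K by rewrite mul0r subr0.
apply: (@initial_le _ (fun u => u * K) (fun=> K)) => // [|u|u /andP[u0 uy]].
- exact: continuous_moment_integrand.
- by apply: is_derive_eq (is_derive1M (is_derive1_id u) (is_derive1_cst K u)) _; ring.
- apply: (@ge0_is_derive1_le _ (fun v => phase v ^+ 1 * expR (- (x * phase v)))
    (fun v => (1 - expR (- v)) * (1 - x * phase v) * expR (- (x * phase v)))) => [|v _|v /andP[uv vy]].
  + exact: ltW.
  + apply: is_derive_eq (is_derive1M (is_derive1X 1 (is_derive_phase v))
     (is_derive1_expR (is_derive1N (is_derive1M (is_derive1_cst x v) (is_derive_phase v))))) _.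
    by rewrite /=; ring.
  + have v0 := lt_le_trans u0 uv.
    rewrite !mulr_ge0 ?expR_ge0// subr_ge0.
      by rewrite expR_le1 oppr_le0 ltW.
    by apply: le_trans xy1; rewrite ler_wpM2l ?(ltW x0)// phase_le_mono// ltW.
Qed.

(** The left side is the integral of the derivative of u e^(-x h(u)), which is
    (1 - x u h') e^(-x h), and u h' >= h by convexity. This inequality expresses that
    the integral of e^(-x h(v / x)) over [0, alpha] increases with x. *)
Lemma partial_moment_scaling x y : 0 < x -> 0 <= y ->
  y * expR (- (x * phase y)) <= partial_moment 0 x y - x * partial_moment 1 x y.
Proof.
move=> x0 y0.
have mi n : mu.-integrable `[0, y] (EFin \o (fun u => phase u ^+ n * expR (- (x * phase u)))).
  apply: continuous_compact_integrable; first exact: segment_compact.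
  exact/continuous_subspaceT/continuous_moment_integrand.
have mi1 : mu.-integrable `[0, y] (EFin \o (fun u => x * (phase u ^+ 1 * expR (- (x * phase u))))).
  apply: continuous_compact_integrable; first exact: segment_compact.
  apply: continuous_subspaceT => u; apply: cvgMl_tmp; exact: continuous_moment_integrand.
have -> : partial_moment 0 x y - x * partial_moment 1 x y =
   \int[mu]_(u in `[0, y]) (phase u ^+ 0 * expR (- (x * phase u))
     - x * (phase u ^+ 1 * expR (- (x * phase u)))).
  by rewrite (RintegralB _ (mi 0%N) mi1)// (RintegralZl _ _ (mi 1%N)).
pose G u := u * expR (- (x * phase u)).
rewrite (_ : y * _ = G y - G 0); last by rewrite /G mul0r subr0.
apply: (@initial_ge _ G (fun u => (1 - x * (u * (1 - expR (- u)))) * expR (- (x * phase u))))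
  => // [u|u|u _].
- apply: cvgB; first exact: continuous_moment_integrand.
  by apply: cvgMl_tmp; exact: continuous_moment_integrand.
- apply: is_derive_eq (is_derive1M (is_derive1_id u)
     (is_derive1_expR (is_derive1N (is_derive1M (is_derive1_cst x u) (is_derive_phase u))))) _.
  by ring.
- rewrite -subr_ge0 (_ : _ - _ = x * (u * (1 - expR (- u)) - phase u) * expR (- (x * phase u))); last by ring.
  by rewrite !mulr_ge0 ?expR_ge0 ?(ltW x0)// subr_ge0 phase_le_slope.
Qed.

Lemma partial_moment0_continuous x y : 0 <= y ->
  {within `[0, y], continuous (partial_moment 0 x)}.
Proof.
move=> y0; apply: parameterized_integral_continuous => //.
apply: continuous_compact_integrable; first exact: segment_compact.
exact/continuous_subspaceT/continuous_moment_integrand.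
Qed.

Lemma partial_moment_MVT n x y y' : 0 < x -> 0 < y -> 0 < y' ->
  exists c, [/\ 0 < c, c <= Num.max y y', `|c - y| <= `|y' - y| &
    partial_moment n x y' - partial_moment n x y =
    phase c ^+ n * expR (- (x * phase c)) * (y' - y)].
Proof.
move=> x0.
have main a b : 0 < a -> a <= b -> exists2 c, a <= c <= b &
    partial_moment n x b - partial_moment n x a = phase c ^+ n * expR (- (x * phase c)) * (b - a).
  move=> a0 ab.
  have pos u : a <= u <= b -> 0 < u by move=> /andP[/(lt_le_trans a0)].
  have [u|u|c cab E] := @MVT_segment _ (partial_moment n x)
     (fun u => phase u ^+ n * expR (- (x * phase u))) a b ab.
  - rewrite in_itv/= => /andP[au ub]; apply: is_derive_partial_moment_r => //.
    exact: lt_trans au.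
  - by apply: is_derive1_within (fun v vab => is_derive_partial_moment_r n x0 (pos v vab)) u.
  - by exists c => //; move: cab; rewrite in_itv.
move=> y0 y'0; have [yy'|/ltW yy'] := leP y y'.
  have [c /andP[c1 c2] E] := main _ _ y0 yy'; exists c; split => //.
  - exact: lt_le_trans c1.
  - by rewrite !ger0_norm ?subr_ge0// lerB.
have [c /andP[c1 c2] E] := main _ _ y'0 yy'; exists c; split => //.
- exact: lt_le_trans c1.
- by rewrite ![`|_ - y|]distrC !ger0_norm ?subr_ge0// lerB.
- by rewrite -opprB E -mulrN opprB.
Qed.

Lemma gap_solution x : 0 < x -> exists2 y, 0 < y & partial_moment 0 x y = side_gap 0 x / 2.
Proof.
move=> x0.
have gl := gap_lower x0; have gu := gap_upper x0.
have xV0 : 0 < x^-1 by rewrite invr_gt0.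
have g0 : 0 < side_gap 0 x by rewrite -(pmulr_rgt0 _ x0); lra.
have Z0 : partial_moment 0 x 0 = 0 by rewrite /partial_moment /moment set_itv1 Rintegral_set1.
have [||c] := @IVT _ (partial_moment 0 x) 0 x^-1 (side_gap 0 x / 2) (ltW xV0).
- exact: partial_moment0_continuous (ltW xV0).
- rewrite Z0 ge_min divr_ge0 ?(ltW g0)//= le_max; apply/orP; right.
  rewrite -(ler_pM2l x0); have := partial_moment0_ge x0 (ltW xV0).
  rewrite divff ?gt_eqF//; have := expR_ge1Dx (1 : R); rewrite expRN => e2.
  have : (expR 1)^-1 <= (2^-1 : R) by rewrite lef_pV2 ?posrE ?expR_gt0//; lra.
  by lra.
rewrite in_itv/= => /andP[c0 _] E; exists c => //.
rewrite lt_neqAle c0 andbT; apply/eqP => c0'.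
by move: E; rewrite -c0' Z0 => /esym/eqP; rewrite gt_eqF// divr_gt0.
Qed.

(** phi(x) = log (x / m(x)). *)
Definition log_ratio x : R := xget 0 [set y | 0 < y /\ partial_moment 0 x y = side_gap 0 x / 2].

Lemma log_ratioP x : 0 < x ->
  0 < log_ratio x /\ partial_moment 0 x (log_ratio x) = side_gap 0 x / 2.
Proof.
move=> /gap_solution[y y0 yE]; rewrite /log_ratio.
by case: xgetP => [z -> //|/(_ y)]; case; split.
Qed.

(** The lower bound uses e^(-x h) <= 1 and x L >= 2/3; the upper one uses h(u) <= u and
    x L <= 1, which give e^alpha <= 2, hence (1 + alpha / 2)^2 <= 2. *)
Lemma log_ratio_bounds x : 0 < x -> 1 / 3 <= x * log_ratio x <= 5 / 6.
Proof.
move=> x0; have [y0 yE] := log_ratioP x0.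
have gl := gap_lower x0; have gu := gap_upper x0.
apply/andP; split.
  have := ler_wpM2l (ltW x0) (partial_moment0_le x0 (ltW y0)); rewrite yE mulrA => H.
  by move: gl H; set p := x * side_gap 0 x; set q := x * log_ratio x; lra.
have := partial_moment0_ge x0 (ltW y0); rewrite yE => H.
set a := x * log_ratio x in H *.
have : 1 / 2 <= expR (- a) by lra.
have a0 : 0 < a by rewrite mulr_gt0.
rewrite expRN => Ha.
have ea2 : expR a <= 2.
  by rewrite -[expR a]invrK -[2%R]invrK lef_pV2 ?posrE ?invr_gt0 ?expR_gt0//; lra.
have : expR a = expR (a / 2) ^+ 2 by rewrite -expRM_natr; congr expR; field.
have := expR_ge1Dx (a / 2); have := expR_gt0 (a / 2).
nra.
Qed.

(** By the mean value theorem in the endpoint, whose derivative e^(-x h) is at least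
    e^(-2) on the relevant range. *)
Lemma log_ratio_continuous x : 0 < x -> {for x, continuous log_ratio}.
Proof.
move=> x0; have c1 : 5 / 6 <= 1 :> R by lra.
have x2 : x < 2 * x by lra.
rewrite /prop_for /continuous_at; apply/subr_cvg0; apply/norm_cvg0P.
have /andP[_] := log_ratio_bounds x0; have := log_ratioP x0.
move: (log_ratio x) => y [y0 yE] xy.
pose e z := side_gap 0 z / 2 - partial_moment 0 z y.
have ce : {for x, continuous e}.
  apply: is_derive1_continuous; apply: is_derive1B; last exact: is_derive_partial_moment_l.
  exact: is_derive1M (is_derive_side_gap 0 x0) (is_derive1_cst 2^-1 x).
have Ee z : 0 < z -> z <= 2 * x -> `|log_ratio z - y| <= expR 2 * `|e z|.
  move=> z0 zx; have [yz0 yzE] := log_ratioP z0.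
  have [c [c0 cmax _]] := partial_moment_MVT 0 z0 y0 yz0.
  rewrite yzE -/(e z) expr0 mul1r => ->; rewrite normrM mulrA ler_peMl//.
  rewrite ger0_norm ?expR_ge0// -expRD -[leLHS]expR0 ler_expR subr_ge0.
  apply: (@le_trans _ _ (z * c)).
    by apply: ler_wpM2l (phase_le (ltW c0)); exact: ltW.
  apply: (@le_trans _ _ (z * Num.max y (log_ratio z))).
    by apply: ler_wpM2l cmax; exact: ltW.
  rewrite maxr_pMr ?(ltW z0)// ge_max; apply/andP; split.
    apply: (@le_trans _ _ (2 * x * y)); first exact: ler_wpM2r (ltW y0) _ _ zx.
    by have := ler_wpM2l (ler0n R 2) (le_trans xy c1); rewrite mulr1 mulrA.
  have /andP[_ zy] := log_ratio_bounds z0.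
  by apply: (le_trans zy); apply: (le_trans c1); rewrite ler1n.
apply: (@squeeze_cvgr _ _ _ _ (cst 0) (fun z => expR 2 * `|e z|)).
- near=> z; rewrite normr_ge0/=; apply: Ee; first by near: z; exact: lt_nbhsr.
  by apply: ltW; near: z; exact: lt_nbhsl.
- exact: cvg_cst.
- rewrite -[X in _ --> X](mulr0 (expR 2)); apply: cvgMl_tmp; apply/norm_cvg0P.
  have ex0 : e x = 0 by rewrite /e yE subrr.
  by rewrite -[X in _ --> X]ex0; exact: ce.
Unshelve. all: by end_near. Qed.

(** Mean value theorem for the moving endpoint: as the intermediate point tends to
    phi(x), the mean slope is a continuous function of [z]. This replaces joint
    differentiability, both for finding phi' and for differentiating along phi. *)
Lemma log_ratio_increment n x : 0 < x -> exists q : R -> R,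
  [/\ {for x, continuous q},
      q x = phase (log_ratio x) ^+ n * expR (- (x * phase (log_ratio x))) &
      \forall z \near x, 0 < z ->
        partial_moment n z (log_ratio z) - partial_moment n z (log_ratio x) =
        q z * (log_ratio z - log_ratio x)].
Proof.
move=> x0; have [y0 yE] := log_ratioP x0.
have /choice[c cP] z : exists c, 0 < z -> `|c - log_ratio x| <= `|log_ratio z - log_ratio x| /\
    partial_moment n z (log_ratio z) - partial_moment n z (log_ratio x) =
    phase c ^+ n * expR (- (z * phase c)) * (log_ratio z - log_ratio x).
  have [z0|z0] := ltP 0 z; last by exists 0.
  have [yz0 _] := log_ratioP z0.
  by have [c [_ _ cz E]] := partial_moment_MVT n z0 y0 yz0; exists c.
have cx : c x = log_ratio x.
  by have [] := cP x x0; rewrite subrr normr0 normr_le0 subr_eq0 => /eqP.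
have cc : {for x, continuous c}.
  rewrite /prop_for /continuous_at cx.
  apply/subr_cvg0; apply/norm_cvg0P.
  apply: (@squeeze_cvgr _ _ _ _ (cst 0) (fun z => `|log_ratio z - log_ratio x|)).
  - near=> z; rewrite normr_ge0/=.
    by have [] := cP z; first by near: z; exact: lt_nbhsr.
  - exact: cvg_cst.
  - apply/norm_cvg0P; apply/subr_cvg0; exact: log_ratio_continuous.
have cpc : {for x, continuous (fun z => phase (c z))}.
  by apply: continuous_comp; [exact: cc|exact: continuous_phase].
exists (fun z => phase (c z) ^+ n * expR (- (z * phase (c z)))); split.
- apply: for_continuousM.
    apply: (@continuous_comp _ _ _ (fun z => phase (c z)) (fun t => t ^+ n)); first exact: cpc.
    exact: exprn_continuous.
  apply: for_continuous_expR; apply: continuousN; apply: for_continuousM; last exact: cpc.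
  exact: is_derive1_continuous (is_derive1_id x).
- by rewrite cx.
- by near=> z; case/cP.
Unshelve. all: by end_near. Qed.

(** phi'(x), read off from e^(-x h(phi)) phi' - int_0^phi h e^(-x h) = L' / 2. *)
Definition log_ratio_slope x : R :=
  expR (x * phase (log_ratio x)) * (partial_moment 1 x (log_ratio x) - side_gap 1 x / 2).

Lemma is_derive_log_ratio x : 0 < x -> is_derive x 1 log_ratio (log_ratio_slope x).
Proof.
move=> x0; have [y0 yE] := log_ratioP x0.
have [q [cq qx qE]] := log_ratio_increment 0 x0.
pose e z := side_gap 0 z / 2 - partial_moment 0 z (log_ratio x).
have de : is_derive x 1 e (partial_moment 1 x (log_ratio x) - side_gap 1 x / 2).
  apply: is_derive_eq (is_derive1B (is_derive1M (is_derive_side_gap 0 x0) (is_derive1_cst 2^-1 x))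
    (is_derive_partial_moment_l 0 (log_ratio x) x0)) _.
  by rewrite mulr0 add0r opprK mulrC addrC mulNr.
have ex : e x = 0 by rewrite /e yE subrr.
have /is_derive1_caratheodory[g [gE cg gx]] := de.
have qx0 : q x != 0 by rewrite qx expr0 mul1r gt_eqF// expR_gt0.
apply: (@local_caratheodory _ (fun z => (q z)^-1 * g z)).
- near=> z.
  have z0 : 0 < z by near: z; exact: lt_nbhsr.
  have qz : q z != 0.
    by near: z; apply: (cvgr_neq0 (q x)).
  have E : 0 < z -> partial_moment 0 z (log_ratio z) - partial_moment 0 z (log_ratio x) =
        q z * (log_ratio z - log_ratio x) by near: z.
  have [_ yzE] := log_ratioP z0.
  by rewrite -mulrA -gE ex subr0 /e -yzE (E z0) mulKf.
- by apply: for_continuousM; [exact: continuousV|exact: cg].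
- by rewrite gx qx expr0 mul1r expRN invrK.
Unshelve. all: by end_near. Qed.

Lemma is_derive_partial_moment_along n x : 0 < x ->
  is_derive x 1 (fun z => partial_moment n z (log_ratio z))
    (phase (log_ratio x) ^+ n * expR (- (x * phase (log_ratio x))) * log_ratio_slope x
     - partial_moment n.+1 x (log_ratio x)).
Proof.
move=> x0; have [q [cq qx qE]] := log_ratio_increment n x0.
have /is_derive1_caratheodory[g [gE cg gx]] := is_derive_log_ratio x0.
have /is_derive1_caratheodory[k [kE ck kx]] := is_derive_partial_moment_l n (log_ratio x) x0.
apply: (@local_caratheodory _ (fun z => q z * g z + k z)).
- near=> z.
  have z0 : 0 < z by near: z; exact: lt_nbhsr.
  have E : 0 < z -> partial_moment n z (log_ratio z) - partial_moment n z (log_ratio x) =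
        q z * (log_ratio z - log_ratio x) by near: z.
  by rewrite mulrDl -mulrA -gE -kE -(E z0) addrA subrK.
- by apply: for_continuousD; [exact: for_continuousM|exact: ck].
- by rewrite gx qx kx.
Unshelve. all: by end_near. Qed.

End implicit_solution.

(** * The convexity estimate *)

Section convexity_estimate.
Context {R : realType}.
Implicit Types x y : R.

(** phi''(x). *)
Definition log_ratio_curv x : R :=
  log_ratio_slope x * (2 * phase (log_ratio x)
    + x * (1 - expR (- log_ratio x)) * log_ratio_slope x)
  + expR (x * phase (log_ratio x)) * (side_gap 2 x / 2 - partial_moment 2 x (log_ratio x)).

Lemma is_derive_log_ratio_slope x : 0 < x ->
  is_derive x 1 log_ratio_slope (log_ratio_curv x).
Proof.
move=> x0; have dl := is_derive_log_ratio x0.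
have dp := is_derive1_comp (is_derive_phase (log_ratio x)) dl.
apply: is_derive_eq (is_derive1M (is_derive1_expR (is_derive1M (is_derive1_id x) dp))
  (is_derive1B (is_derive_partial_moment_along 1 x0)
    (is_derive1M (is_derive_side_gap 1 x0) (is_derive1_cst 2^-1 x)))) _.
rewrite /log_ratio_curv /= (expRN (x * phase (log_ratio x))).
have : expR (x * phase (log_ratio x)) * (partial_moment 1 x (log_ratio x) - side_gap 1 x / 2)
  = log_ratio_slope x by [].
have := expR_gt0 (x * phase (log_ratio x)).
move: (expR (x * phase (log_ratio x))) (partial_moment 1 _ _) (partial_moment 2 _ _)
  (side_gap 1 _) (side_gap 2 _) (log_ratio_slope x) (phase _) (expR _) => E A B g1 g2 s h e E0 <-.
by field; rewrite gt_eqF.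
Qed.

(** The difference of the cubic with 2/27 has a simple root at 1/3. *)
Lemma cubic_margin (a : R) : 1 / 3 <= a <= 5 / 6 -> 1 / 14 < a ^+ 2 * (1 - a).
Proof.
move=> /andP[a1 a2]; apply: (@lt_le_trans _ _ (2 / 27)); first by lra.
rewrite -subr_ge0 (_ : _ - _ = (a - 1 / 3) * (2 / 3 * a - a ^+ 2 + 2 / 9)); last by field.
by rewrite mulr_ge0; nra.
Qed.

(** Here y = phi, h = h(phi), d = h'(phi), E = e^(-x h(phi)), s = phi', c = phi'';
    Z, A, B are the integrals over [0, phi] of e^(-x h), h e^(-x h), h^2 e^(-x h),
    and g0, g1, g2 are L, -L', L''. Multiplied by E the claim reads

      E (1 - x d) x s^2 + 2 x h E (-s) - 2 A + x B - (x L)'' / 2 > 0.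

    First -s >= y / x, so the second term dominates 2 A. Then
    E (1 - x d) >= (1 - x h) (1 - x d) >= 1 - x y, because h + d = y, so the first
    term is at least (x y)^2 (1 - x y) / x^3, which exceeds (xL)'' / 2. *)
Lemma convexity_algebra (x y h d E Z A B g0 g1 g2 s c : R) :
    0 < x -> 0 < y -> 0 < E -> 0 <= h -> 0 <= B ->
    E * s = A - g1 / 2 ->
    E * c = E * s * (2 * h + x * d * s) + (g2 / 2 - B) ->
    y * E <= Z - x * A -> Z = g0 / 2 -> g0 - x * g1 <= 0 ->
    A <= y * (h * E) -> x * g2 - 2 * g1 <= 1 / 7 / x ^+ 3 ->
    h = y - d -> d <= y -> 0 <= d -> 1 - x * h <= E -> 1 / 3 <= x * y <= 5 / 6 ->
  0 < x * s ^+ 2 - 2 * s - x * c.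
Proof.
move=> x0 y0 E0 h0 B0 Es Ec yE Zg g01 Ah gc hd dy d0 Eh xy.
have /andP[_ xy1] := xy.
have xs : y <= x * - s.
  rewrite -subr_ge0 -(pmulr_rge0 _ E0).
  have -> : E * (x * - s - y) = - x * (E * s) - y * E by ring.
  rewrite Es; nra.
have s0 : 0 < - s by rewrite -(pmulr_rgt0 _ x0) (lt_le_trans y0).
have xd1 : 0 <= 1 - x * d by nra.
rewrite -(pmulr_rgt0 _ E0).
have -> : E * (x * s ^+ 2 - 2 * s - x * c) =
  E * (1 - x * d) * (x * s ^+ 2) + 2 * (h * E) * (x * - s) - 2 * A + x * B - (x * g2 - 2 * g1) / 2.
  have -> : E * (x * s ^+ 2 - 2 * s - x * c) = E * s * (x * s) - 2 * (E * s) - x * (E * c) by ring.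
  rewrite Ec; move: Es => /eqP; rewrite -subr_eq0 => /eqP H; apply/eqP.
  rewrite -subr_eq0; apply/eqP.
  by rewrite -[RHS](mulr0 (- 2)) -H; field.
have t1 : 2 * A <= 2 * (h * E) * (x * - s).
  by have : 0 <= h * E * (x * - s - y); [rewrite !mulr_ge0 ?subr_ge0// ltW|lra].
have t2 : 0 <= x * B by rewrite mulr_ge0// ltW.
have t3 : 1 - x * y <= E * (1 - x * d).
  have : 0 <= (E - (1 - x * h)) * (1 - x * d) by rewrite mulr_ge0// subr_ge0.
  have : 0 <= (x * d) * (x * h) by rewrite !mulr_ge0// ltW.
  rewrite hd; nra.
have x3 : 0 < x ^+ 3 by rewrite exprn_gt0.
have t4 : (x * y) ^+ 2 / x ^+ 3 <= x * s ^+ 2.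
  rewrite ler_pdivrMr//.
  have -> : x * s ^+ 2 * x ^+ 3 = x ^+ 2 * (x * - s) ^+ 2 by ring.
  rewrite exprMn; apply: ler_wpM2l; first exact: sqr_ge0.
  rewrite ler_pXn2r// ?nnegrE ?(ltW y0)//.
  exact: le_trans (ltW y0) xs.
have t5 : (1 - x * y) * ((x * y) ^+ 2 / x ^+ 3) <= E * (1 - x * d) * (x * s ^+ 2).
  apply: ler_pM => //; first by rewrite subr_ge0; lra.
  by rewrite divr_ge0 ?sqr_ge0// ltW.
have t6 : 1 / 14 / x ^+ 3 < (1 - x * y) * ((x * y) ^+ 2 / x ^+ 3).
  by rewrite [ltRHS]mulrA ltr_pM2r ?invr_gt0// [ltRHS]mulrC; exact: cubic_margin.
have t7 : (x * g2 - 2 * g1) / 2 <= 1 / 14 / x ^+ 3.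
  have -> : 1 / 14 / x ^+ 3 = 1 / 7 / x ^+ 3 / 2 by field; rewrite gt_eqF.
  by rewrite ler_pM2r.
move: t1 t2 t5 t6 t7.
move: (E * (1 - x * d) * (x * s ^+ 2)) (2 * (h * E) * (x * - s)) (x * B)
  ((x * g2 - 2 * g1) / 2) (1 / 14 / x ^+ 3) ((1 - x * y) * _) => *.
lra.
Qed.

Lemma log_ratio_convexity x : 0 < x ->
  0 < x * log_ratio_slope x ^+ 2 - 2 * log_ratio_slope x - x * log_ratio_curv x.
Proof.
move=> x0; have [y0 yE] := log_ratioP x0.
have Einv : expR (- (x * phase (log_ratio x))) * expR (x * phase (log_ratio x)) = 1.
  by rewrite mulrC expRxMexpNx_1.
have xy := log_ratio_bounds x0.
have c1 : 5 / 6 <= 1 :> R by lra.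
apply: (@convexity_algebra x (log_ratio x) (phase (log_ratio x)) (1 - expR (- log_ratio x))
  (expR (- (x * phase (log_ratio x)))) (partial_moment 0 x (log_ratio x))
  (partial_moment 1 x (log_ratio x)) (partial_moment 2 x (log_ratio x))
  (side_gap 0 x) (side_gap 1 x) (side_gap 2 x)) => //.
- exact: expR_gt0.
- exact: phase_ge0.
- exact: partial_moment_ge0.
- by rewrite /log_ratio_slope mulrA Einv mul1r.
- by rewrite /log_ratio_curv [LHS]mulrDr mulrA [X in _ + X]mulrA Einv mul1r.
- exact: partial_moment_scaling (ltW y0).
- exact: gap_decreasing.
- apply: partial_moment1_le => //; first exact: ltW.
  have /andP[_ xy1] := xy; apply: le_trans (le_trans xy1 c1).
  by apply: ler_wpM2l (phase_le (ltW y0)); exact: ltW.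
- exact: gap_curvature.
- by rewrite /phase; ring.
- by have := phase_ge0 (log_ratio x); rewrite /phase; move: (expR _) => *; lra.
- by rewrite subr_ge0 expR_le1 oppr_le0 ltW.
- exact: expR_ge1Dx.
Qed.

End convexity_estimate.

(** * The substitution in the gamma integral *)

Section gamma_substitution.
Context {R : realType}.
Notation mu := (@lebesgue_measure R).
Implicit Types (x y t u a b : R).

Local Notation half_line := (@mkset R (fun t => t \in `[0%R, +oo[)).

Definition gamma_scale x : R := x `^ x * expR (- x).

Lemma gamma_integrand_ge0 x t : 0 <= gamma_integrand x t.
Proof. by rewrite mulr_ge0 ?expR_ge0 ?powR_ge0. Qed.

Lemma measurable_gamma_integrand x : measurable_fun setT (gamma_integrand x).
Proof.
apply: measurable_funM; last exact: measurable_powR.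
by apply: measurableT_comp => //; exact: measurableT_comp.
Qed.

Lemma gamma_integrand_continuous x t : 0 < t -> {for t, continuous (gamma_integrand x)}.
Proof.
move=> t0; exact: (is_derive1_continuous (is_derive1M (is_derive1_expR (is_derive1N (is_derive1_id t)))
  (is_derive1_powR (x - 1) t0))).
Qed.

Lemma gamma_integrand_within x a b : 0 < a -> {within `[a, b], continuous (gamma_integrand x)}.
Proof.
move=> a0; apply: continuous_in_subspaceT => t; rewrite inE/= in_itv/= => /andP[at_ _].
exact: gamma_integrand_continuous (lt_le_trans a0 at_).
Qed.

(** The pointwise form of the substitution t = x e^(-u). *)
Lemma gamma_integrand_exp x u : 0 < x ->
  gamma_integrand x (x * expR (- u)) * (x * expR (- u)) =
  gamma_scale x * expR (- (x * phase u)).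
Proof.
move=> x0; set t := x * expR (- u).
have t0 : 0 < t by rewrite mulr_gt0 ?expR_gt0.
rewrite /gamma_integrand -mulrA [t `^ _ * t]mulrC mulr_powRB1 ?(ltW t0)//.
rewrite {2}/t powRM ?(ltW x0) ?expR_ge0// -expRM.
rewrite /gamma_scale mulrCA -!mulrA -!expRD; congr (_ * expR _).
by rewrite /t /phase; ring.
Qed.

Lemma gamma_integral_segment x a b : 0 < x -> a <= b ->
  (\int[mu]_(t in `[(x * expR (- b))%R, (x * expR (- a))%R]) (gamma_integrand x t)%:E =
   \int[mu]_(u in `[a, b]) (gamma_scale x * expR (- (x * phase u)))%R%:E)%E.
Proof.
move=> x0 ab.
pose F u := x * expR (- u).
have dF u : is_derive u 1 F (- F u).
  apply: is_derive_eq (is_derive1M (is_derive1_cst x u) (is_derive1_expR (is_derive1N (is_derive1_id u)))) _.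
  by rewrite /F; ring.
have F'E : F^`()%classic = (fun u => - F u).
  by apply/funext => u; exact: is_derive1_derive1 (dF u).
have cF u : {for u, continuous F} by exact: is_derive1_continuous (dF u).
have cF' : continuous F^`()%classic.
  by rewrite F'E => u; apply: continuousN; exact: cF.
have := @integration_by_substitution_decreasing R F (gamma_integrand x) a b ab.
rewrite -/(F a) -/(F b) => ->.
- apply: eq_integral => u _; congr (EFin _).
  by rewrite fctE/= F'E opprK gamma_integrand_exp.
- by move=> u v _ _ uv; rewrite /F ltr_pM2l// ltr_expR ltrN2.
- by move=> u _; exact: cF'.
- apply/cvg_ex; eexists; apply: cvg_at_right_filter; exact: cF'.
- apply/cvg_ex; eexists; apply: cvg_at_left_filter; exact: cF'.
- split => [u _| |]; first by case: (dF u).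
  + by apply: cvg_at_right_filter; exact: cF.
  + by apply: cvg_at_left_filter; exact: cF.
- by apply: gamma_integrand_within; rewrite mulr_gt0 ?expR_gt0.
Qed.

(** Monotone convergence carries an equality of integrals over increasing sets to
    the limit: the substitution t = x e^(-u) is made on segments, where its
    derivative is bounded. *)
Lemma integral_exhaustion (f g : R -> R) (A B : (set R)^nat) :
    measurable_fun setT f -> measurable_fun setT g ->
    (forall t, 0 <= f t) -> (forall t, 0 <= g t) ->
    (forall n, measurable (A n)) -> (forall n, measurable (B n)) ->
    nondecreasing_seq A -> nondecreasing_seq B ->
    (forall n, (\int[mu]_(t in A n) (f t)%:E = \int[mu]_(t in B n) (g t)%:E)%E) ->
  (\int[mu]_(t in \bigcup_n A n) (f t)%:E = \int[mu]_(t in \bigcup_n B n) (g t)%:E)%E.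
Proof.
move=> mf mg f0 g0 mA mB ndA ndB AB.
have cvg_of (h : R -> R) (C : (set R)^nat) : measurable_fun setT h ->
    (forall t, 0 <= h t) -> (forall n, measurable (C n)) ->
    nondecreasing_seq C ->
    (\int[mu]_(t in C n) (h t)%:E)%E @[n --> \oo] --> (\int[mu]_(t in \bigcup_n C n) (h t)%:E)%E.
  move=> mh h0 mC ndC; apply: ge0_nondecreasing_set_cvg_integral => //.
  - by move=> n; apply: measurable_funTS; exact/measurable_EFinP.
  - by move=> n t _; rewrite lee_fin.
have cA := cvg_of f A mf f0 mA ndA; have cB := cvg_of g B mg g0 mB ndB.
have E : (fun n => (\int[mu]_(t in A n) (f t)%:E)%E) = (fun n => (\int[mu]_(t in B n) (g t)%:E)%E).
  by apply/funext => n; exact: AB.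
rewrite E in cA.
exact: (cvg_unique _ cA cB).
Qed.

Let measurable_kernel x : measurable_fun setT (fun u : R => gamma_scale x * expR (- (x * phase u))).
Proof.
apply: continuous_measurable_fun => u.
apply: cvgMl_tmp; apply: continuous_exp_phase; exact: continuous_phase.
Qed.

Let kernel_ge0 x u : 0 <= gamma_scale x * expR (- (x * phase u)).
Proof. by rewrite !mulr_ge0 ?expR_ge0 ?powR_ge0. Qed.

Lemma gamma_integral_initial x a : 0 < x ->
  (\int[mu]_(t in `]0%R, (x * expR (- a))%R]) (gamma_integrand x t)%:E =
   \int[mu]_(u in `[a, +oo[) (gamma_scale x * expR (- (x * phase u)))%R%:E)%E.
Proof.
move=> x0.
pose A (n : nat) : set R := `[x * expR (- (a + n%:R)), x * expR (- a)]%classic.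
pose B (n : nat) : set R := `[a, a + n%:R]%classic.
have UA : \bigcup_n A n = `]0, x * expR (- a)]%classic.
  apply/seteqP; split => t /=.
    move=> [n _]; rewrite /A/= !in_itv/= => /andP[t1 ->]; rewrite andbT.
    by apply: lt_le_trans t1; rewrite mulr_gt0 ?expR_gt0.
  rewrite in_itv/= => /andP[t0 ta].
  pose v := ln (x / t) - a.
  exists (Num.trunc `|v|).+1 => //; rewrite /A/= in_itv/= ta andbT.
  have vn : v <= (Num.trunc `|v|).+1%:R.
    by apply: le_trans (ler_norm v) _; apply: ltW; exact: truncnS_gt.
  have -> : t = x * expR (- (a + v)).
    rewrite /v addrC subrK expRN lnK ?posrE ?divr_gt0// invf_div mulrC divfK//.
    by rewrite gt_eqF.
  by rewrite ler_pM2l// ler_expR lerN2 lerD2l.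
have UB : \bigcup_n B n = `[a, +oo[%classic.
  apply/seteqP; split => u /=.
    by move=> [n _]; rewrite /B/= !in_itv/= andbT => /andP[].
  rewrite in_itv/= andbT => au.
  exists (Num.trunc (u - a)).+1 => //; rewrite /B/= in_itv/= au/=.
  by rewrite -lerBlDl; apply: ltW; exact: truncnS_gt.
rewrite -UA -UB; apply: integral_exhaustion.
- exact: measurable_gamma_integrand.
- exact: measurable_kernel.
- exact: gamma_integrand_ge0.
- exact: kernel_ge0.
- by move=> n; exact: measurable_itv.
- by move=> n; exact: measurable_itv.
- move=> m n mn; rewrite subsetEset; apply: subset_itvr; rewrite bnd_simp.
  by rewrite ler_pM2l// ler_expR lerN2 lerD2l ler_nat.
- by move=> m n mn; rewrite subsetEset; apply: subset_itvl; rewrite bnd_simp lerD2l ler_nat.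
- by move=> n; apply: gamma_integral_segment; rewrite // lerDl.
Qed.

Lemma gamma_integral_total x : 0 < x ->
  (\int[mu]_(t in `]0%R, +oo[) (gamma_integrand x t)%:E =
   \int[mu]_u (gamma_scale x * expR (- (x * phase u)))%R%:E)%E.
Proof.
move=> x0.
pose A (n : nat) : set R := `]0, x * expR (- (- n%:R))]%classic.
pose B (n : nat) : set R := `[- n%:R, +oo[%classic.
have UA : \bigcup_n A n = `]0, +oo[%classic.
  apply/seteqP; split => t /=.
    by move=> [n _]; rewrite /A/= !in_itv/= andbT => /andP[].
  rewrite in_itv/= andbT => t0.
  exists (Num.trunc (t / x)).+1 => //; rewrite /A/= in_itv/= t0/= opprK.
  rewrite -ler_pdivrMl// mulrC.
  apply: (le_trans (ltW (truncnS_gt _))).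
  by apply: le_trans (expR_ge1Dx _); rewrite lerDr.
have UB : \bigcup_n B n = setT.
  apply/seteqP; split => u //= _.
  exists (Num.trunc `|u|).+1 => //; rewrite /B/= in_itv/= andbT lerNl.
  by apply: (le_trans (ler_norm _)); rewrite normrN; apply: ltW; exact: truncnS_gt.
rewrite -UA -UB; apply: integral_exhaustion.
- exact: measurable_gamma_integrand.
- exact: measurable_kernel.
- exact: gamma_integrand_ge0.
- exact: kernel_ge0.
- by move=> n; exact: measurable_itv.
- by move=> n; exact: measurable_itv.
- move=> m n mn; rewrite subsetEset; apply: subset_itvl; rewrite bnd_simp.
  by rewrite !opprK ler_pM2l// ler_expR ler_nat.
- by move=> m n mn; rewrite subsetEset; apply: subset_itvr; rewrite bnd_simp lerN2 ler_nat.
- by move=> n; exact: gamma_integral_initial.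
Qed.

End gamma_substitution.

(** * The median *)

Section median.
Context {R : realType}.
Notation mu := (@lebesgue_measure R).
Implicit Types (x y z t u a b : R).

Local Notation half_line := (@mkset R (fun t => t \in `[0%R, +oo[)).

Let exp_phase x u : R := expR (- (x * phase u)).

Let moment0E (B : set R) (f : R -> R) x :
  moment B f 0 x = \int[mu]_(u in B) expR (- (x * f u)).
Proof. by apply: eq_Rintegral => u _; rewrite expr0 mul1r. Qed.

Let int_pos x : 0 < x -> mu.-integrable half_line (fun u => (exp_phase x u)%:E).
Proof.
move=> x0; apply: integrable_exp_growth => //; first exact: continuous_phase.
by move=> u _; exact: phase_geB1.
Qed.

Let int_neg x : 0 < x -> mu.-integrable half_line (fun u => (exp_phase x (- u))%:E).
Proof.
move=> x0; apply: (@integrable_exp_growth _ (fun u => phase (- u))) => //.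
  exact: continuous_phaseN.
exact: phase_geNB1.
Qed.

Let scaled_integral (B : set R) (g : R -> R) (c : R) : measurable B ->
    mu.-integrable B (EFin \o g) ->
  (\int[mu]_(u in B) (c * g u)%R%:E = (c * \int[mu]_(u in B) g u)%R%:E)%E.
Proof.
move=> mB ig.
have -> : (\int[mu]_(u in B) (c * g u)%R%:E = c%:E * \int[mu]_(u in B) (g u)%:E)%E.
  by apply: (integralZl _ ig).
by rewrite EFinM /Rintegral fineK//; exact: integrable_fin_num.
Qed.

(** With y = phi this is the lower half of the gamma integral. *)
Lemma gamma_integral_tail x y : 0 < x -> 0 <= y ->
  (\int[mu]_(t in `]0%R, (x * expR (- y))%R[) (gamma_integrand x t)%:E =
   (gamma_scale x * (moment half_line phase 0 x - partial_moment 0 x y))%R%:E)%E.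
Proof.
move=> x0 y0.
rewrite integral_itv_bndo_bndc; last first.
  by apply/measurable_EFinP/measurable_funTS; exact: measurable_gamma_integrand.
rewrite gamma_integral_initial// scaled_integral//.
  rewrite /partial_moment !moment0E; congr (EFin (_ * _)).
  have iy : mu.-integrable `]y, +oo[ (EFin \o exp_phase x).
    by apply: integrableS (int_pos x0) => //; apply: subset_itvr; rewrite bnd_simp.
  rewrite (@Rintegral_itvB _ (exp_phase x) (BLeft 0) +oo%O y); last 3 first.
  - exact: int_pos.
  - by rewrite bnd_simp.
  - by rewrite bnd_simp.
  by rewrite Rintegral_itv_obnd_cbnd.
by apply: integrableS (int_pos x0) => //; apply: subset_itvr; rewrite bnd_simp.
Qed.

Lemma gamma_integral_full x : 0 < x ->
  (\int[mu]_(t in `]0%R, +oo[) (gamma_integrand x t)%:E =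
   (gamma_scale x * (moment half_line phase 0 x +
     moment half_line (fun u => phase (- u)) 0 x))%R%:E)%E.
Proof.
move=> x0; rewrite gamma_integral_total//.
pose G u := gamma_scale x * exp_phase x u.
have cG : continuous G.
  by move=> u; apply: cvgMl_tmp; apply: continuous_exp_phase; exact: continuous_phase.
have G0 u : 0 <= G u by rewrite !mulr_ge0 ?expR_ge0 ?powR_ge0.
have mG (D : set R) : measurable_fun D (fun u => (G u)%:E).
  by apply/measurable_EFinP/measurable_funTS; exact: continuous_measurable_fun.
have -> : [set: R] = (`]-oo, 0%R]%classic `|` `]0%R, +oo[%classic : set R).
  by apply/seteqP; split => u //= _; rewrite !in_itv/= andbT; apply/orP; case: leP.
transitivity (\int[mu]_(u in `]-oo, 0%R]) (G u)%:E + \int[mu]_(u in `]0%R, +oo[) (G u)%:E)%E.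
  apply: ge0_integral_setU => //; first exact: mG.
    by move=> u _; rewrite lee_fin; exact: G0.
  rewrite disj_set2E; apply/eqP; rewrite -subset0 => u /= []; rewrite !in_itv/= andbT => u0.
    by rewrite ltNge u0.
rewrite addeC integral_itv_obnd_cbnd//.
have -> : (\int[mu]_(u in `]-oo, 0%R]) (G u)%:E = \int[mu]_(u in `[0%R, +oo[) (G (- u))%:E)%E.
  have := @ge0_integration_by_substitutionNy R G 0.
  rewrite oppr0; apply => //; exact: continuous_subspaceT.
rewrite scaled_integral//; last exact: int_pos.
rewrite (scaled_integral (g := fun u => exp_phase x (- u)))//; last exact: int_neg.
by rewrite -EFinD !moment0E -mulrDr.
Qed.

(** J+ - L / 2 = (J+ + J-) / 2, where J+ and J- are the two half-line integrals, of
    difference L. *)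
Lemma is_gamma_median_log_ratio x : 0 < x -> is_gamma_median x (x * expR (- log_ratio x)).
Proof.
move=> x0; have [y0 yE] := log_ratioP x0.
split; first by rewrite mulr_gt0 ?expR_gt0.
rewrite gamma_integral_tail ?ltW// gamma_integral_full// -EFinM yE /side_gap.
congr EFin.
by move: (moment _ _ _ _) (moment _ _ _ _) => p q; field.
Qed.

(** The gamma integrand is bounded below by a positive constant on a segment between
    two distinct candidates. *)
Lemma is_gamma_median_unique x y z : 0 < x -> is_gamma_median x y -> is_gamma_median x z -> y = z.
Proof.
move=> x0.
suff main a b : 0 < a -> a < b ->
    (\int[mu]_(t in `]0%R, a[) (gamma_integrand x t)%:E < +oo)%E ->
    (\int[mu]_(t in `]0%R, a[) (gamma_integrand x t)%:E
     < \int[mu]_(t in `]0%R, b[) (gamma_integrand x t)%:E)%E.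
  have fin a : is_gamma_median x a -> (\int[mu]_(t in `]0%R, a[) (gamma_integrand x t)%:E < +oo)%E.
    by move=> [_ ->]; rewrite gamma_integral_full// -EFinM ltry.
  move=> ym zm; have [yz|zy|//] := ltgtP y z.
    by have := main _ _ ym.1 yz (fin _ ym); rewrite ym.2 zm.2 ltxx.
  by have := main _ _ zm.1 zy (fin _ zm); rewrite ym.2 zm.2 ltxx.
move=> a0 ab afin.
have mg (D : set R) : measurable_fun D (fun t => (gamma_integrand x t)%:E).
  by apply/measurable_EFinP/measurable_funTS; exact: measurable_gamma_integrand.
have -> : `]0%R, b[%classic = `]0%R, a[%classic `|` `[a, b[%classic :> set R.
  by rewrite -itv_bndbnd_setU// bnd_simp// ltW.
rewrite ge0_integral_setU//=; last 3 first.
- exact: mg.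
- by move=> t _; rewrite lee_fin gamma_integrand_ge0.
- rewrite disj_set2E; apply/eqP; rewrite -subset0 => t /= []; rewrite !in_itv/= => /andP[_ ta] /andP[at_ _].
  by move: ta; rewrite ltNge at_.
rewrite lteDl//; last first.
  by rewrite ge0_fin_numE// integral_ge0// => t _; rewrite lee_fin gamma_integrand_ge0.
have [c cab cmin] := EVT_min (ltW ab) (@gamma_integrand_within R x a b a0).
have c0 : 0 < c by move: cab; rewrite in_itv/= => /andP[/(lt_le_trans a0)].
have g0 : 0 < gamma_integrand x c by rewrite mulr_gt0 ?expR_gt0 ?powR_gt0.
apply: (@lt_le_trans _ _ (\int[mu]_(t in `[a, b[) (gamma_integrand x c)%:E)%E).
  rewrite integral_cst//= lebesgue_measure_itv/= lte_fin ab -EFinB -EFinM lte_fin.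
  by rewrite mulr_gt0// subr_gt0.
apply: ge0_le_integral => //.
- by move=> t tI; rewrite lee_fin ltW.
- exact: mg.
- move=> t /=; rewrite in_itv/= => /andP[at_ tb]; rewrite lee_fin cmin// in_itv/= at_ ltW//.
Qed.

Definition median_fun x : R := x * expR (- log_ratio x).
Definition median_slope x : R := expR (- log_ratio x) * (1 - x * log_ratio_slope x).
Definition median_curv x : R := expR (- log_ratio x) *
  (x * log_ratio_slope x ^+ 2 - 2 * log_ratio_slope x - x * log_ratio_curv x).

Lemma is_derive_median x : 0 < x -> is_derive x 1 median_fun (median_slope x).
Proof.
move=> x0; apply: is_derive_eq (is_derive1M (is_derive1_id x)
  (is_derive1_expR (is_derive1N (is_derive_log_ratio x0)))) _.
by rewrite /median_slope; ring.
Qed.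

Lemma is_derive_median_slope x : 0 < x -> is_derive x 1 median_slope (median_curv x).
Proof.
move=> x0; apply: is_derive_eq (is_derive1M (is_derive1_expR (is_derive1N (is_derive_log_ratio x0)))
  (is_derive1B (is_derive1_cst 1 x) (is_derive1M (is_derive1_id x) (is_derive_log_ratio_slope x0)))) _.
by rewrite /median_curv; ring.
Qed.

Lemma median_curv_gt0 x : 0 < x -> 0 < median_curv x.
Proof. by move=> x0; rewrite mulr_gt0 ?expR_gt0//; exact: log_ratio_convexity. Qed.

Lemma strictly_convex_of_derive2 (f f1 f2 : R -> R) x y t :
    (forall z, 0 < z -> is_derive z 1 f (f1 z)) ->
    (forall z, 0 < z -> is_derive z 1 f1 (f2 z)) ->
    (forall z, 0 < z -> 0 < f2 z) ->
    0 < x -> x < y -> 0 < t -> t < 1 ->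
  f (t * x + (1 - t) * y) < t * f x + (1 - t) * f y.
Proof.
move=> df df1 f2_gt0 x0 xy t0 t1; set z := t * x + (1 - t) * y.
have t1' : 0 < 1 - t by rewrite subr_gt0.
have yx : 0 < y - x by rewrite subr_gt0.
have zx : z - x = (1 - t) * (y - x) by rewrite /z; ring.
have yz : y - z = t * (y - x) by rewrite /z; ring.
have xz' : x < z by rewrite -subr_gt0 zx mulr_gt0.
have zy' : z < y by rewrite -subr_gt0 yz mulr_gt0.
have mvt a b : 0 < a -> a < b -> exists2 c, a < c < b & f b - f a = f1 c * (b - a).
  move=> a0 ab; have [u|u|c cab E] := @MVT _ f f1 a b ab.
  - by rewrite in_itv/= => /andP[au _]; apply: df; exact: lt_trans au.
  - by apply: (is_derive1_within (df := f1)) => v /andP[av _]; apply: df; exact: lt_le_trans av.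
  - by exists c => //; move: cab; rewrite in_itv.
have [c1 /andP[xc1 c1z] E1] := mvt _ _ x0 xz'.
have [c2 /andP[zc2 c2y] E2] := mvt _ _ (lt_trans x0 xz') zy'.
have f1c : f1 c1 < f1 c2.
  apply: (@gt0_is_derive1_lt _ f1 f2) => [|u /andP[cu _]|u /andP[cu _]].
  - exact: lt_trans zc2.
  - by apply: df1; rewrite (lt_le_trans _ cu)// (lt_trans x0).
  - by apply: f2_gt0; rewrite (lt_trans _ cu)// (lt_trans x0).
rewrite -subr_gt0.
have -> : t * f x + (1 - t) * f y - f z = (1 - t) * (f y - f z) - t * (f z - f x) by ring.
rewrite E1 E2 zx yz.
have -> : (1 - t) * (f1 c2 * (t * (y - x))) - t * (f1 c1 * ((1 - t) * (y - x))) =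
  (1 - t) * t * (y - x) * (f1 c2 - f1 c1) by ring.
by rewrite !mulr_gt0// subr_gt0.
Qed.

End median.

Theorem theorem1p1 (R : realType) :
  (forall x : R, 0 < x -> exists! y : R, is_gamma_median x y) /\
  (forall m : R -> R,
    (forall x : R, 0 < x -> is_gamma_median x (m x)) ->
    (forall x : R, 0 < x ->
      [/\ derivable m x 1, derivable m^`()%classic x 1 & 0 < m^`(2)%classic x]) /\
    @strictly_convex_function R R^o [set x : R | 0 < x] m).
Proof.
split=> [x x0|m mP].
  exists (median_fun x); split; first exact: is_gamma_median_log_ratio.
  by move=> y; apply: is_gamma_median_unique => //; exact: is_gamma_median_log_ratio.
have mE (x : R) : 0 < x -> median_fun x = m x.
  move=> x0; apply: (is_gamma_median_unique x0); last exact: mP.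
  exact: is_gamma_median_log_ratio.
have dm (x : R) : 0 < x -> is_derive x 1 m (median_slope x).
  move=> x0; apply: (near_eq_is_derive _ (is_derive_median x0)).
  by near=> z; apply: mE; near: z; exact: lt_nbhsr.
have dm1 (x : R) : 0 < x -> is_derive x 1 m^`()%classic (median_curv x).
  move=> x0; apply: (near_eq_is_derive _ (is_derive_median_slope x0)).
  near=> z; apply/esym/is_derive1_derive1/dm; near: z; exact: lt_nbhsr.
split=> [x x0|t t0 t1 x y].
  split; [by case: (dm x x0)|by case: (dm1 x x0)|].
  by rewrite derive1nS (is_derive1_derive1 (dm1 x x0)) median_curv_gt0.
rewrite !inE/= => x0 y0 xy.
have conv := strictly_convex_of_derive2 dm (@is_derive_median_slope R) (@median_curv_gt0 R).
have [lt_xy|lt_yx|eq_xy] := ltgtP x y.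
- exact: (conv x y t%:num).
- have := conv y x (1 - t%:num) y0 lt_yx.
  rewrite subr_gt0 => /(_ t1); rewrite gtrBl => /(_ t0).
  rewrite subKr [X in m X]addrC [X in _ < X]addrC.
  exact.
- by rewrite eq_xy eqxx in xy.
Unshelve. all: by end_near. Qed.
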